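(* Let $n\ge1$, let $\Gamma$ be a group of type $\mathrm{F}_{n+1}$ with a corresponding Eilenberg-MacLane space with universal cover $X$, and with a fixed finite generating set $S$, and let $\pi$ be a representation of $\Gamma$ on a finite-dimensional Banach space $E$. If $H^n(\Gamma,\pi)=0$, then there exists $\varepsilon=\varepsilon(\Gamma,S,X,\pi)>0$ such that $H^n(\Gamma,\rho)=0$ for every representation $\rho$ of $\Gamma$ on $E$ that is an $\varepsilon$-deformation of $\pi$.
   Context: A representation of $\Gamma$ on a Banach space $E$ is a homomorphism $\gamma\mapsto\pi_\gamma$ from $\Gamma$ to the group of bounded invertible linear operators on $E$. A representation $\rho$ on the same $E$ is an $\varepsilon$-deformation of $\pi$ if $\sup_{s\in S}\|\pi_s-\rho_s\|_{B(E)}\le\varepsilon$. $H^n(\Gamma,\pi)$ denotes the group cohomology of $\Gamma$ with coefficients in the $\Gamma$-module $(E,\pi)$. $\Gamma$ is of type $\mathrm{F}_k$ if it admits an Eilenberg-MacLane space $K(\Gamma,1)$ which is a simplicial complex with finite $k$-skeleton. *)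

(* Defs.v *)
From HB Require Import structures.
From mathcomp Require Import all_boot all_order all_algebra finmap complex.
From mathcomp Require Import all_classical all_reals topology normedtype.

Set Implicit Arguments.
Unset Strict Implicit.
Unset Printing Implicit Defensive.

Import Order.TTheory GRing.Theory Num.Theory.
Import numFieldNormedType.Exports.

Local Open Scope classical_set_scope.
Local Open Scope ring_scope.

Definition contractible (R : realType) (T : topologicalType) : Prop :=
  exists (x0 : T) (H : T * R -> T),
    [/\ {within [set: T] `*` `[0, 1], continuous H},
        forall x, H (x, 0) = x
      & forall x, H (x, 1) = x0].

(* The sheet condition says that p restricts to a homeomorphism from W i onto
   U; continuity of that restriction comes from continuity of p in
   covering_map. *)
Definition evenly_covered (T B : topologicalType) (p : T -> B) (U : set B) :
    Prop :=
  exists (I : Type) (W : I -> set T),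
    [/\ p @^-1` U = \bigcup_i W i,
        trivIset setT W,
        forall i, open (W i)
      & forall i, set_bij (W i) U p /\
          forall A, open A -> A `<=` W i -> open (p @` A)].

Definition covering_map (T B : topologicalType) (p : T -> B) : Prop :=
  [/\ continuous p, range p = [set: B]
    & forall b, exists U : set B, [/\ open U, U b & evenly_covered p U]].

Record simplicial_complex := SimplicialComplex {
  vertex : choiceType;
  simplex : set {fset vertex};
  simplex1 : forall v, simplex [fset v]%fset;
  simplex_neq0 : forall s, simplex s -> s != fset0;
  simplexS : forall s t, simplex s -> (t `<=` s)%fset -> t != fset0 -> simplex t
}.

(* A simplex with k + 1 vertices has dimension k. *)
Definition finite_skeleton (X : simplicial_complex) (k : nat) : Prop :=
  finite_set [set s | @simplex X s /\ (#|` s| <= k.+1)%N].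

Record simplicial_map (X Y : simplicial_complex) := SimplicialMap {
  smap :> vertex X -> vertex Y;
  smapP : forall s, @simplex X s -> @simplex Y (smap @` s)%fset
}.

(* s is the carrier of x: the unique simplex whose interior contains x. *)
Definition barycentric (R : realType) (X : simplicial_complex)
    (x : vertex X -> R) (s : {fset vertex X}) : Prop :=
  [/\ simplex s, forall v, 0 <= x v, forall v, (v \in s) = (x v != 0)
    & \sum_(v <- s) x v = 1].

Record realization (R : realType) (X : simplicial_complex) := Realization {
  coord :> vertex X -> R;
  coordP : exists s, barycentric coord s
}.

Lemma realization_eq (R : realType) (X : simplicial_complex)
  (x y : realization R X) : coord x = coord y -> x = y.
Proof.
case: x y => [x hx] [y hy] /= xy; subst y.
by congr Realization; exact: Prop_irrelevance.
Qed.

HB.instance Definition _ (R : realType) (X : simplicial_complex) :=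
  gen_eqMixin (realization R X).
HB.instance Definition _ (R : realType) (X : simplicial_complex) :=
  gen_choiceMixin (realization R X).

Definition in_closed_simplex (R : realType) (X : simplicial_complex)
    (s : {fset vertex X}) (x : realization R X) : Prop :=
  forall v, x v != 0 -> v \in s.

(* The weak (coherent) topology: A is open iff its trace on every closed simplex
   |s| is open for the Euclidean topology of |s|. *)
Definition realization_open (R : realType) (X : simplicial_complex)
    (A : set (realization R X)) : Prop :=
  forall s, simplex s -> forall x, in_closed_simplex s x -> A x ->
    exists2 e : R, 0 < e & forall y, in_closed_simplex s y ->
      (forall v, v \in s -> `|x v - y v| < e) -> A y.

Section RealizationTopology.
Variables (R : realType) (X : simplicial_complex).

Let openT : realization_open [set: realization R X].
Proof. by move=> s _ x _ _; exists 1. Qed.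

Let openI (A B : set (realization R X)) :
  realization_open A -> realization_open B -> realization_open (A `&` B).
Proof.
move=> oA oB s ss x xs [Ax Bx].
have [e e0 eA] := oA s ss x xs Ax; have [d d0 dB] := oB s ss x xs Bx.
exists (Num.min e d); first by rewrite lt_min e0.
move=> y ys xy; split; [apply: eA | apply: dB] => // v /xy;
  by rewrite lt_min => /andP[].
Qed.

Let open_bigU (I : Type) (F : I -> set (realization R X)) :
  (forall i, realization_open (F i)) -> realization_open (\bigcup_i F i).
Proof.
move=> oF s ss x xs [i _ Fx]; have [e e0 eF] := oF i s ss x xs Fx.
by exists e => // y ys xy; exists i => //; exact: eF.
Qed.

HB.instance Definition _ :=
  isOpenTopological.Build (realization R X) openT openI open_bigU.

End RealizationTopology.

Section Realize.
Variables (R : realType) (X Y : simplicial_complex) (f : simplicial_map X Y).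

(* The affine extension of f: a vertex w receives the total weight of its
   preimages (a sum with finite support). *)
Definition realize_coord (x : realization R X) (w : vertex Y) : R :=
  \sum_(v \in f @^-1` [set w]) x v.

Lemma realize_coordE (x : realization R X) s w : barycentric x s ->
  realize_coord x w = \sum_(v <- s | f v == w) x v.
Proof.
case=> _ _ xE _; rewrite /realize_coord (fsbigE [seq v <- s | f v == w]).
- rewrite big_filter_cond; apply: eq_bigl => v.
  by case: eqVneq => //= fvw; rewrite mem_set.
- exact/filter_uniq/fset_uniq.
- by move=> v /=; rewrite mem_filter => /andP[/eqP].
- move=> v /= fvw; rewrite mem_filter fvw eqxx /= xE.
  by move/negPn/eqP.
Qed.

Lemma realize_coordP (x : realization R X) :
  exists s, barycentric (realize_coord x) s.
Proof.
have [s xs] := coordP x; have [ss x0 xE x1] := xs.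
exists (f @` s)%fset; split.
- exact: smapP.
- by move=> w; rewrite (realize_coordE _ xs); apply: sumr_ge0.
- move=> w; rewrite (realize_coordE _ xs) psumr_neq0 //.
  apply/imfsetP/hasP => [[v /= vs ->]|[v vs /andP[/eqP <- _]]]; exists v => //.
  by rewrite eqxx lt_def x0 -xE vs.
- rewrite -x1 [RHS](partition_big_imfset _ f); apply: eq_bigr => w _.
  exact: realize_coordE.
Qed.

Definition realize (x : realization R X) : realization R Y :=
  Realization (realize_coordP x).

End Realize.

(* The universal cover of K(Gamma, 1) carries the simplicial structure lifted
   from the base, so that the deck group Gamma acts by simplicial maps. Since
   the total space is contractible, a regular covering with group Gamma is the
   universal one and Gamma is the fundamental group of the base. *)
Record eilenberg_maclane (R : realType) (Gamma : groupType) := EilenbergMacLane {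
  em_base : simplicial_complex;
  em_cover : simplicial_complex;
  em_proj : simplicial_map em_cover em_base;
  em_act : Gamma -> simplicial_map em_cover em_cover;
  em_proj_covering : covering_map (@realize R _ _ em_proj);
  em_cover_contractible : contractible R (realization R em_cover);
  em_act1 : forall v, em_act 1%g v = v;
  em_actM : forall g h v, em_act (g * h)%g v = em_act g (em_act h v);
  em_deck : forall g (x : realization R em_cover),
    realize em_proj (realize (em_act g) x) = realize em_proj x;
  em_simply_transitive : forall x y : realization R em_cover,
    realize em_proj x = realize em_proj y ->
    exists! g, realize (em_act g) x = y
}.

Definition generates (Gamma : groupType) (S : set Gamma) : Prop :=
  forall H : {pred Gamma}, group_closed H -> (forall s, S s -> s \in H) ->
    forall g, g \in H.

(* K is the field of real or of complex numbers and emb embeds the reals. *)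
Variant scalar_field (R : realType) :
    forall K : numFieldType, (R -> K) -> Prop :=
  | RealScalars : @scalar_field R R (fun x => x)
  | ComplexScalars : @scalar_field R (complex R) (real_complex R).

Definition finite_dimensional (K : numFieldType) (E : lmodType K) : Prop :=
  exists (m : nat) (b : 'I_m -> E),
    forall x, exists c : 'I_m -> K, x = \sum_i c i *: b i.

(* Norms on E are K-valued, whence emb; the operator norm itself is real. *)
Definition opnorm (R : realType) (K : numFieldType) (emb : R -> K)
    (E : normedModType K) (T : E -> E) : R :=
  inf [set c : R | 0 <= c /\ forall x, `|T x| <= emb c * `|x|].

Record representation (Gamma : groupType) (K : numFieldType)
    (E : normedModType K) := Representation {
  rep :> Gamma -> {linear E -> E};
  rep_bounded : forall g, exists c : K, forall x, `|rep g x| <= c * `|x|;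
  rep1 : forall x, rep 1%g x = x;
  repM : forall g h x, rep (g * h)%g x = rep g (rep h x)
}.

Definition deformation (R : realType) (K : numFieldType) (emb : R -> K)
    (Gamma : groupType) (S : set Gamma) (E : normedModType K) (eps : R)
    (pi rho : representation Gamma E) : Prop :=
  sup [set opnorm emb (pi s \- rho s) | s in S] <= eps.

(* Group cohomology by homogeneous cochains: those of degree n are the
   equivariant functions of n + 1 group elements. *)

Section Cohomology.
Variables (Gamma : groupType) (K : numFieldType) (E : normedModType K).
Variable pi : representation Gamma E.

Definition cochain (n : nat) : set (('I_n.+1 -> Gamma) -> E) :=
  [set f | forall g x, f (fun i => g * x i)%g = pi g (f x)].

Definition coboundary_map (n : nat) (f : ('I_n.+1 -> Gamma) -> E)
    (x : 'I_n.+2 -> Gamma) : E :=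
  \sum_(i < n.+2) (-1) ^+ i *: f (x \o lift i).

Definition cocycles (n : nat) : set (('I_n.+1 -> Gamma) -> E) :=
  [set f | cochain f /\ forall x, coboundary_map f x = 0].

Definition coboundaries (n : nat) : set (('I_n.+1 -> Gamma) -> E) :=
  match n with
  | 0 => [set fun _ => 0]
  | m.+1 => @coboundary_map m @` @cochain m
  end.

Definition cohomology_vanishes (n : nat) : Prop :=
  @cocycles n = @coboundaries n.

End Cohomology.

(* Main.v *)
(* In each degree [k <= n + 1] the group acts freely and with finitely many
   orbits on the ordered [k]-simplices of the contractible complex [X], so the
   equivariant simplicial cochains form a finite-dimensional space on which the
   coboundary depends continuously on the representation. Exactness at degree
   [n] is an open condition because the rank is lower semicontinuous.

   That these cochains compute group cohomology needs the acyclicity of [X]. A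
   cycle is replaced by a homologous cycle of tuples of very close points,
   obtained by filling simplex by simplex, a convex set being acyclic for such
   tuples. This cycle is pushed along the contraction [H] in small time steps,
   each point [(x, t)] being sent to a vertex whose open star contains [H] of a
   ball around [(x, t)] of radius a Lebesgue number. *)
Require Import Defs.
From HB Require Import structures.
From mathcomp Require Import all_boot all_order all_algebra finmap complex.
From mathcomp Require Import all_classical all_reals topology normedtype.
From mathcomp Require Import ring lra.
Import Order.TTheory GRing.Theory Num.Theory.
Import numFieldNormedType.Exports.
Local Open Scope classical_set_scope.
Local Open Scope ring_scope.

(** * Cochains on lists *)

(** The passage to simplicial cochains must be available for [pi] and for every [rho] alike, so it
    is made on integral chains, before any representation enters: the comparison maps and homotopies
    are [Gamma]-equivariant, and an equivariant cochain for any [rho] can be evaluated on them. The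
    comparison has two halves. Tuples in [Gamma] and arbitrary tuples of vertices of [X] are related
    by equivariant maps in both directions, the one towards [Gamma] existing because the action on
    vertices is free. Arbitrary tuples and those spanning a simplex are related by an equivariant
    retraction, and this half rests on acyclicity. Simplices are ordered and may have repeated
    vertices, because prisms, and cones over a vertex already present, produce repetitions. Once
    representatives of the orbits are fixed, the cochains for all [rho] are parametrized by one real
    matrix space, and [rho] enters only through the entries of the coboundary. Complex scalars are
    absorbed by a real basis of [E]. *)

Ltac cancel_terms :=
  apply/eqP; rewrite -subr_eq0; apply/eqP; rewrite -[LHS]addr0;
  rewrite ?(opprD, opprK, oppr0) -?addrA;
  repeat match goal with
  | |- - ?x + (?x + _) = 0 => rewrite addKr
  | |- ?x + (- ?x + _) = 0 => rewrite addNKr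
  | |- - ?x + _ = 0 => rewrite [_ + (x + _)]addrCA
  | |- ?x + _ = 0 => rewrite [_ + (- x + _)]addrCA
  end; rewrite ?addr0; try reflexivity.

Section ListCochains.
Context {E : zmodType}.

(* A list of [k + 1] points is an ordered [k]-simplex; the empty list makes the
   cochain complex the augmented one. *)
Fixpoint codiff {V : Type} (f : seq V -> E) (s : seq V) : E :=
  if s is x :: t then f t - codiff (fun u => f (x :: u)) t else 0.

Fixpoint is_face {V : Type} (t s : seq V) : Prop :=
  if s is x :: u then t = u \/ exists2 t', t = x :: t' & is_face t' u
  else False.

(* A chain is encoded by the evaluation of cochains on it; its boundary is then
   the functional [fun f => F (codiff f)]. *)
Definition chain (V : Type) := (seq V -> E) -> E.

(** Integral combinations of lists in [P]. This predicate replaces formal sums: it records the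
    support, and additivity in the cochain follows from it by induction. *)
Inductive span {V : Type} (P : seq V -> Prop) : chain V -> Prop :=
| span_zero : span P (fun _ => 0)
| span_sub (F G : chain V) :
    span P F -> span P G -> span P (fun f => F f - G f)
| span_gen s : P s -> span P (fun f => f s).

Lemma span_ext {V : Type} (P : seq V -> Prop) (F G : chain V) :
  (forall f, F f = G f) -> span P F -> span P G.
Proof. by move=> FG; have -> : G = F by apply/funext => f; rewrite FG. Qed.

Lemma span_add {V : Type} (P : seq V -> Prop) (F G : chain V) :
  span P F -> span P G -> span P (fun f => F f + G f).
Proof.
move=> PF PG.
apply: (span_ext P (fun f => F f - (0 - G f))).
  by move=> f; rewrite sub0r opprK.
by do 2 apply: span_sub => //; exact: span_zero.
Qed.

Lemma span_bind {V W : Type} (P : seq V -> Prop) (Q : seq W -> Prop)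
    (F : chain V) (T : seq V -> chain W) :
  span P F -> (forall s, P s -> span Q (T s)) ->
  span Q (fun f => F (fun s => T s f)).
Proof.
move=> PF PT; elim: PF => [|G1 G2 _ IH1 _ IH2|s Ps]; first exact: span_zero.
- exact: (span_sub _ _ _ IH1 IH2).
- exact: PT.
Qed.

Lemma span_map {V W : Type} (P : seq V -> Prop) (Q : seq W -> Prop)
    (h : seq V -> seq W) (F : chain V) :
  (forall s, P s -> Q (h s)) -> span P F -> span Q (fun f => F (fun s => f (h s))).
Proof.
move=> PQ PF; apply: (span_bind _ _ _ (fun s f => f (h s)) PF) => s Ps.
exact/(span_gen _ (h s))/PQ.
Qed.

Lemma span_mono {V : Type} (P Q : seq V -> Prop) (F : chain V) :
  (forall s, P s -> Q s) -> span P F -> span Q F.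
Proof. exact: (span_map _ _ id). Qed.

Lemma eq_span {V : Type} (P : seq V -> Prop) (F : chain V) (f g : seq V -> E) :
  span P F -> (forall s, P s -> f s = g s) -> F f = F g.
Proof.
move=> PF fg; elim: PF => [//|G1 G2 _ IH1 _ IH2|s Ps]; last exact: fg.
by rewrite IH1 IH2.
Qed.

Lemma spanBf {V : Type} (P : seq V -> Prop) (F : chain V) (f g : seq V -> E) :
  span P F -> F (fun s => f s - g s) = F f - F g.
Proof.
elim=> [|G1 G2 _ IH1 _ IH2|//]; first by rewrite subr0.
by rewrite IH1 IH2 !opprD addrACA.
Qed.

Lemma span0f {V : Type} (P : seq V -> Prop) (F : chain V) (f : seq V -> E) :
  span P F -> (forall s, P s -> f s = 0) -> F f = 0.
Proof.
move=> PF f0; rewrite -(subrr (F f)) -(spanBf _ _ _ _ PF).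
by apply: (eq_span _ _ _ _ PF) => s Ps; rewrite f0 // subrr.
Qed.

Lemma span_additive {V : Type} (P : seq V -> Prop) (F : chain V)
    (h : E -> E) (f : seq V -> E) :
  {morph h : x y / x - y} -> span P F -> F (fun s => h (f s)) = h (F f).
Proof.
move=> hB; elim=> [|G1 G2 _ IH1 _ IH2|//]; last by rewrite IH1 IH2 hB.
by rewrite -[in RHS](subrr 0) hB subrr.
Qed.

Lemma span_codiff {V : Type} (Q : seq V -> Prop) (s : seq V) :
  (forall t, is_face t s -> Q t) -> span Q (fun f => codiff f s).
Proof.
elim: s Q => [|x s IH] Q sQ /=; first exact: span_zero.
apply: span_sub; first by apply: span_gen; apply: sQ; left.
apply: (span_map (fun t => is_face t s) _ (cons x) (fun f => codiff f s)).
  by move=> t ts; apply: sQ; right; exists t.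
exact: IH.
Qed.

Lemma span_face {V : Type} (s : seq V) :
  span (fun t => is_face t s) (fun f => codiff f s).
Proof. exact: span_codiff. Qed.

Lemma eq_codiff {V : Type} (f g : seq V -> E) (s : seq V) :
  (forall t, is_face t s -> f t = g t) -> codiff f s = codiff g s.
Proof. exact: (eq_span _ _ _ _ (span_face s)). Qed.

Lemma codiffB {V : Type} (f g : seq V -> E) (s : seq V) :
  codiff (fun t => f t - g t) s = codiff f s - codiff g s.
Proof. exact: (spanBf _ _ _ _ (span_face s)). Qed.

Lemma codiff_additive {V : Type} (h : E -> E) (f : seq V -> E) (s : seq V) :
  {morph h : x y / x - y} -> codiff (fun t => h (f t)) s = h (codiff f s).
Proof.
by move=> hB; exact: (span_additive _ (fun f => codiff f s) _ _ hB (span_face s)).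
Qed.

Lemma codiff_map {V W : Type} (a : V -> W) (f : seq W -> E) (s : seq V) :
  codiff f (map a s) = codiff (fun t => f (map a t)) s.
Proof. by elim: s f => //= x s IH f; rewrite IH. Qed.

Lemma codiff_codiff {V : Type} (f : seq V -> E) (s : seq V) :
  codiff (codiff f) s = 0.
Proof.
elim: s f => //= x s IH f; rewrite codiffB IH subr0.
by rewrite subrr.
Qed.

Lemma is_face_size {V : Type} (t s : seq V) : is_face t s -> size s = (size t).+1.
Proof. by elim: s t => //= x s IH t [->//|[t' -> /IH ->]]. Qed.

Lemma is_face_sub {V : eqType} (t s : seq V) : is_face t s -> {subset t <= s}.
Proof.
elim: s t => //= x s IH t [->|[t' -> /IH ts]] y; rewrite !inE; first by move->; rewrite orbT.
by case/predU1P => [->|/ts ->]; rewrite ?eqxx ?orbT.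
Qed.

(* The chain [v * F], whose boundary is [F - v * (boundary of F)]. *)
Definition cone {V : Type} (v : V) (F : chain V) : chain V :=
  fun f => F (fun s => f (v :: s)).

Lemma cone_codiff {V : Type} (P : seq V -> Prop) (v : V) (F : chain V) f :
  span P F -> cone v F (codiff f) = F f - F (codiff (fun s => f (v :: s))).
Proof. by move=> PF; rewrite /cone /= -(spanBf _ _ _ _ PF). Qed.

(** The alternating sum of the lists [a x_0, ..., a x_i, b x_i, ..., b x_k]: the usual prism between
    the images of a simplex under two vertex maps. *)
Fixpoint prism {V W : Type} (a b : V -> W) (s : seq V) : chain W := fun f =>
  if s is x :: t then
    f [:: a x, b x & map b t] - prism a b t (fun u => f (a x :: u))
  else 0.

Lemma span_prism {V : Type} {W : eqType} (a b : V -> W) (s : seq V) :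
  span (fun t => size t = (size s).+1 /\ {subset t <= map a s ++ map b s})
    (prism a b s).
Proof.
elim: s => [|x s IH] /=; first exact: span_zero.
apply: span_sub.
  apply: (span_gen _ [:: a x, b x & map b s]); split; first by rewrite /= size_map.
  by move=> y; rewrite !(inE, mem_cat) => /or3P[->|->|->]; rewrite ?orbT.
apply: (span_map _ _ (cons (a x)) _ _ IH) => t [sz ts]; split; first by rewrite /= sz.
move=> y; rewrite inE => /predU1P[->|/ts]; first by rewrite inE eqxx.
by rewrite !(inE, mem_cat) => /orP[->|->]; rewrite ?orbT.
Qed.

Lemma prismB {V W : Type} (a b : V -> W) (s : seq V) (f g : seq W -> E) :
  prism a b s (fun t => f t - g t) = prism a b s f - prism a b s g.
Proof.
elim: s f g => [|x s IH] f g /=; first by rewrite subr0.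
by rewrite IH !opprD addrACA.
Qed.

Lemma prism_codiff {V W : Type} (a b : V -> W) (f : seq W -> E) (s : seq V) :
  prism a b s (codiff f) =
  f (map b s) - f (map a s) - codiff (fun t => prism a b t f) s.
Proof.
elim: s f => [|x s IH] f /=; first by rewrite subrr subr0.
rewrite prismB IH codiffB codiff_map.
cancel_terms.
Qed.

Lemma prism_map {V W V' W' : Type} (a b : V -> W) (a' b' : V' -> W')
    (g : V -> V') (h : W -> W') (s : seq V) (f : seq W' -> E) :
  (forall x, a' (g x) = h (a x)) -> (forall x, b' (g x) = h (b x)) ->
  prism a' b' (map g s) f = prism a b s (fun t => f (map h t)).
Proof.
move=> ag bg; elim: s f => //= x s IH f.
rewrite IH ag bg -!map_comp; congr (f [:: _, _ & _] - _).
by apply: eq_map => y /=.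
Qed.

(** The prisms between consecutive maps are added up and their ends telescope. The support condition
    only compares two consecutive images of a single list. *)
Lemma homotopic_chains {V : Type} {W : eqType} (a : nat -> V -> W) (M : nat)
    (z : chain V) (P : seq V -> Prop) (Q : seq W -> Prop) :
  span P z -> (forall f, z (codiff f) = 0) ->
  (forall j, (j < M)%N -> forall s, P s -> forall t, size t = (size s).+1 ->
     {subset t <= map (a j) s ++ map (a j.+1) s} -> Q t) ->
  exists w, span Q w /\
    forall f, w (codiff f) = z (fun s => f (map (a M) s)) - z (fun s => f (map (a 0%N) s)).
Proof.
move=> Pz z0; elim: M => [|M IH] PQ.
  by exists (fun=> 0); split=> [|f]; [exact: span_zero|rewrite subrr].
have [j jM s Ps t|w [Qw wE]] := IH; first exact: PQ (ltnW jM) s Ps t.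
exists (fun f => w f + z (fun s => prism (a M) (a M.+1) s f)); split.
  apply: span_add => //; apply: (span_bind _ _ _ (prism (a M) (a M.+1)) Pz) => s Ps.
  by apply: (span_mono _ _ _ _ (span_prism _ _ _)) => t [st ts]; exact: PQ ts.
move=> f; rewrite wE.
rewrite (funext (prism_codiff (a M) (a M.+1) f)).
rewrite !(spanBf _ _ _ _ Pz) z0.
by cancel_terms.
Qed.

(** * Chain maps built by induction on the size of a simplex *)

Section Extend.
Context {V W : Type} (base : chain W) (fill : seq V -> chain W -> chain W).

(** The counter makes the recursion structural; it is started at the size of the list and faces are
    shorter by exactly one, so it stays in step. *)
Fixpoint extend_rec (n : nat) (s : seq V) : chain W :=
  if n is m.+1 then
    fill s (fun f => codiff (fun t => extend_rec m t f) s)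
  else base.

(* The function [T] on simplices defined by [T s = fill s (T (boundary of s))]. *)
Definition extend (s : seq V) : chain W := extend_rec (size s) s.

Lemma extendE (s : seq V) : s <> [::] ->
  extend s = fill s (fun f => codiff (fun t => extend t f) s).
Proof.
case: s => // x s _; rewrite {1}/extend; cbn [size extend_rec]; congr fill.
apply/funext => f; apply: eq_codiff => t /is_face_size[st].
by rewrite /extend st.
Qed.

End Extend.

Lemma extend_equivariant {V W : Type} (base : chain W) fill (g : V -> V)
    (h : W -> W) :
  (forall f, base (fun t => f (map h t)) = base f) ->
  (forall s z, s <> [::] -> fill (map g s) (fun f => z (fun t => f (map h t))) =
     fun f => fill s z (fun t => f (map h t))) ->
  forall s f, extend base fill (map g s) f =
    extend base fill s (fun t => f (map h t)).
Proof.
move=> hbase hfill s; elim: {s}(size s) {-2}s (leqnn (size s)) => [|n IH] [|x s] sn f //;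
  try by rewrite /extend /= hbase.
have ex : forall y u, extend base fill (y :: u) =
    fill (y :: u) (fun f => codiff (fun t => extend base fill t f) (y :: u)).
  by move=> y u; apply: extendE.
rewrite (ex x s) [map g _]/= (ex (g x)) -/(map g (x :: s)).
transitivity (fill (map g (x :: s)) (fun f => (fun f' => codiff (fun t =>
    extend base fill t f') (x :: s)) (fun t => f (map h t))) f).
  congr (fill _ _ _); apply/funext => {}f; rewrite codiff_map.
  apply: eq_codiff => t ts; apply: IH.
  by move: ts sn => /is_face_size/= [<-].
exact: (congr1 (fun F => F f) (hfill (x :: s)
  (fun f' => codiff (fun t => extend base fill t f') (x :: s)) _)).
Qed.

(** The method of acyclic carriers, with [Phi s] as the carrier of [s]. Since [T] commutes with
    boundaries on the faces, [T] of the boundary of [s] is a cycle; only its filling inside the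
    carrier is left to the last hypothesis. *)
Lemma extend_chain_map {V W : Type} (T : seq V -> chain W)
    (Q : seq V -> Prop) (Phi : seq V -> seq W -> Prop) :
  (forall s t, Q s -> is_face t s -> Q t) ->
  T [::] = (fun f => f [::]) -> Phi [::] [::] ->
  (forall s, Q s -> s <> [::] ->
     span (fun p => exists2 t, is_face t s & Phi t p)
       (fun f => codiff (fun t => T t f) s) ->
     (forall f, codiff (fun t => T t (codiff f)) s = 0) ->
     span (Phi s) (T s) /\
     forall f, T s (codiff f) = codiff (fun t => T t f) s) ->
  forall s, Q s -> span (Phi s) (T s) /\
     forall f, T s (codiff f) = codiff (fun t => T t f) s.
Proof.
move=> Qface T0 Phi0 step s.
elim: {s}(size s) {-2}s (leqnn (size s)) => [|n IH] [|x s] sn Qs //;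
  try by rewrite T0; split=> //; exact: (span_gen _ [::]).
have IH' t : is_face t (x :: s) -> span (Phi t) (T t) /\
     forall f, T t (codiff f) = codiff (fun t => T t f) t.
  move=> ts; apply: IH (Qface _ _ Qs ts).
  by move: sn; rewrite (is_face_size _ _ ts).
apply: step => //.
  apply: (span_bind _ _ _ T (span_face (x :: s))) => t ts.
  by apply: span_mono (IH' t ts).1 => p; exists t.
move=> f; rewrite -[RHS](codiff_codiff (fun t => T t f) (x :: s)).
by apply: eq_codiff => t ts; exact: (IH' t ts).2.
Qed.

Section ConeHomotopy.
Context {V : Type} (T : seq V -> chain V).

(* A homotopy from the identity to the chain map [T], built from the cones over
   the first vertex: [h s = s_0 * (T s - s - h (boundary of s))]. *)
Definition cone_homotopy : seq V -> chain V :=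
  extend (fun=> 0) (fun s z f =>
    if s is x :: _ then
      T s (fun t => f (x :: t)) - f (x :: s) - z (fun t => f (x :: t))
    else 0).

Lemma cone_homotopy_nil : cone_homotopy [::] = fun=> 0.
Proof. by []. Qed.

Lemma cone_homotopyE x s : cone_homotopy (x :: s) = fun f =>
  T (x :: s) (fun t => f (x :: t)) - f [:: x, x & s] -
  codiff (fun u => cone_homotopy u (fun t => f (x :: t))) (x :: s).
Proof. by rewrite {1}/cone_homotopy extendE. Qed.

Lemma span_cone_homotopy (Q : seq V -> Prop) (Psi : seq V -> seq V -> Prop) :
  (forall s t, Q s -> is_face t s -> Q t) ->
  (forall x s, Q (x :: s) -> span (fun t => Psi (x :: s) (x :: t)) (T (x :: s))) ->
  (forall x s, Q (x :: s) -> Psi (x :: s) [:: x, x & s]) ->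
  (forall x s t p, Q (x :: s) -> is_face t (x :: s) -> Psi t p -> Psi (x :: s) (x :: p)) ->
  forall s, Q s -> span (Psi s) (cone_homotopy s).
Proof.
move=> Qface PsiT Psix Psiface s.
elim: {s}(size s) {-2}s (leqnn (size s)) => [|n IH] [|x s] //= sn Qs;
  try by rewrite cone_homotopy_nil; exact: span_zero.
rewrite cone_homotopyE; apply: span_sub; last first.
  apply: (span_bind _ _ _ (fun u f => cone_homotopy u (fun t => f (x :: t))) (span_face _)) => t ts.
  have Qt := Qface _ _ Qs ts.
  apply: span_map (IH t _ Qt); first by move=> p; exact: Psiface ts.
  by move/is_face_size: ts => [<-].
apply: span_sub; last exact/(span_gen _ [:: x, x & s])/Psix.
exact: (span_map _ _ (cons x) _ _ (PsiT _ _ Qs)).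
Qed.

(** By induction on the faces, [T s - s - h (boundary of s)] is a cycle, so its cone over the first
    vertex has it as boundary. *)
Lemma cone_homotopy_codiff (Q : seq V -> Prop) (P : seq V -> seq V -> Prop) :
  (forall s t, Q s -> is_face t s -> Q t) ->
  (forall f, T [::] f = f [::]) ->
  (forall s, Q s -> span (P s) (T s)) ->
  (forall s f, Q s -> T s (codiff f) = codiff (fun t => T t f) s) ->
  forall s f, Q s -> cone_homotopy s (codiff f) =
    T s f - f s - codiff (fun t => cone_homotopy t f) s.
Proof.
move=> Qface T0 PT Tchain s.
have sph u : Q u -> span (fun _ => True) (cone_homotopy u).
  apply: (span_cone_homotopy Q (fun _ _ => True)) => // x t Qt.
  by apply: span_mono (PT _ Qt).
elim: {s}(size s) {-2}s (leqnn (size s)) => [|n IH] [|x s] sn f Qs //.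
- by rewrite cone_homotopy_nil T0 subrr /= subr0.
- by rewrite cone_homotopy_nil T0 subrr /= subr0.
rewrite cone_homotopyE.
set fx := fun t => f (x :: t).
have dfx : (fun t => codiff f (x :: t)) = fun t => f t - codiff fx t by [].
rewrite dfx (spanBf _ _ _ _ (PT _ Qs)) Tchain //.
rewrite (_ : codiff f [:: x, x & s] = f (x :: s) - codiff fx (x :: s)) //.
have -> : codiff (fun u => cone_homotopy u (fun t => f t - codiff fx t)) (x :: s) =
    codiff (fun u => cone_homotopy u f) (x :: s) -
    (codiff (fun u => T u fx) (x :: s) - codiff fx (x :: s) -
     codiff (codiff (fun u => cone_homotopy u fx)) (x :: s)).
  rewrite -!codiffB; apply: eq_codiff => t ts; have Qt := Qface _ _ Qs ts.
  rewrite (spanBf _ _ _ _ (sph _ Qt)) IH //.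
  by move/is_face_size: ts sn => /= [<-].
rewrite codiff_codiff.
by cancel_terms.
Qed.

(** The cone point is the first vertex of the list, so it moves along with the list. *)
Lemma cone_homotopy_equivariant (g : V -> V) :
  (forall s f, T (map g s) f = T s (fun t => f (map g t))) ->
  forall s f, cone_homotopy (map g s) f = cone_homotopy s (fun t => f (map g t)).
Proof.
move=> gT; apply: extend_equivariant => // -[|x s] z // _; apply/funext => f.
by rewrite /= (gT (x :: s)).
Qed.

End ConeHomotopy.

End ListCochains.

(** * Points of simplices *)

Section Geometry.
Context {R : realType} {X : simplicial_complex}.
Implicit Types (l s : seq (vertex X)) (x y : vertex X -> R).

(* The empty list is allowed, as the simplex of dimension -1. *)
Definition spans_simplex s : Prop :=
  s <> [::] -> simplex [fset v in s]%fset.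

Lemma spans_simplexS s t : {subset t <= s} -> spans_simplex s -> spans_simplex t.
Proof.
move=> ts ss t0.
have s0 : s <> [::] by case: t t0 ts => // v t _ /(_ v (mem_head _ _)); case: s {ss}.
apply: simplexS (ss s0) _ _; first by apply/fsubsetP => v; rewrite !inE; exact: ts.
by case: t t0 {ts} => // v t _; apply/fset0Pn; exists v; rewrite !inE eqxx.
Qed.

Definition in_simplex l x : Prop :=
  [/\ forall v, 0 <= x v, forall v, v \notin l -> x v = 0
    & \sum_(v <- undup l) x v = 1].

Lemma sum_in_simplex (l m : seq (vertex X)) x :
  uniq l -> uniq m -> {subset m <= l} -> (forall v, v \notin m -> x v = 0) ->
  \sum_(v <- l) x v = \sum_(v <- m) x v.
Proof.
move=> ul um ml x0; rewrite (bigID (mem m)) /= [X in _ + X]big1 ?addr0; last first.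
  by move=> v; exact: x0.
rewrite -big_filter; apply: perm_big; apply: uniq_perm => //; first exact: filter_uniq.
by move=> v; rewrite mem_filter; apply: andb_idr; exact: ml.
Qed.

Lemma in_simplexS s l x : {subset s <= l} -> in_simplex s x -> in_simplex l x.
Proof.
move=> sl [x0 xs x1]; split=> //.
  by move=> v vl; apply: xs; apply: contra vl; exact: sl.
rewrite -x1; apply: sum_in_simplex; rewrite ?undup_uniq //.
  by move=> v; rewrite !mem_undup; exact: sl.
by move=> v; rewrite mem_undup; exact: xs.
Qed.

Lemma in_simplex_supp l m x : in_simplex l x -> (forall v, x v != 0 -> v \in m) ->
  in_simplex m x.
Proof.
move=> [x0 xl x1] xm.
have xm0 v : v \notin m -> x v = 0 by apply: contraNeq; exact: xm.
split=> //; rewrite -x1.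
rewrite (sum_in_simplex (undup m) [seq v <- undup l | x v != 0]).
- rewrite (sum_in_simplex (undup l) [seq v <- undup l | x v != 0]) ?filter_uniq ?undup_uniq //.
    by move=> v; rewrite mem_filter => /andP[].
  by move=> v; rewrite mem_filter mem_undup negb_and negbK => /orP[/eqP//|]; exact: xl.
- exact: undup_uniq.
- by rewrite filter_uniq ?undup_uniq.
- by move=> v; rewrite mem_filter !mem_undup => /andP[/xm].
- by move=> v; rewrite mem_filter mem_undup negb_and negbK => /orP[/eqP//|]; exact: xl.
Qed.

Lemma in_simplex_convex l x y (a : R) : in_simplex l x -> in_simplex l y ->
  0 <= a <= 1 -> in_simplex l (fun v => (1 - a) * x v + a * y v).
Proof.
move=> [x0 xl x1] [y0 yl y1] /andP[a0 a1]; split=> [v|v vl|].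
- by rewrite addr_ge0 // mulr_ge0 // subr_ge0.
- by rewrite xl // yl // !mulr0 addr0.
- by rewrite big_split /= -!mulr_sumr x1 y1 !mulr1 subrK.
Qed.

Lemma in_simplex_vertex l w : w \in l -> in_simplex l (fun v => (v == w)%:R).
Proof.
move=> wl; split=> [v|v|]; first exact: ler0n.
  by case: eqVneq => // ->; rewrite wl.
rewrite (sum_in_simplex _ [:: w]) ?undup_uniq //.
- by rewrite big_seq1 eqxx.
- by move=> v; rewrite inE mem_undup => /eqP ->.
- by move=> v; rewrite inE => /negPf ->.
Qed.

Lemma in_simplex_le1 l x v : in_simplex l x -> x v <= 1.
Proof.
move=> [x0 xl x1]; have [vl|/xl ->//] := boolP (v \in l).
rewrite -x1 (bigD1_seq v) ?mem_undup ?undup_uniq //= lerDl.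
by apply: sumr_ge0.
Qed.

Lemma in_simplex_barycentric l x : spans_simplex l -> in_simplex l x ->
  exists t, barycentric x t.
Proof.
move=> sl [x0 xl x1]; exists [fset v in [seq v <- l | x v != 0]]%fset.
have ex : exists v, v \in [seq v <- l | x v != 0].
  apply: contrapT => /forallNP h; move/eqP: x1; apply/negP.
  rewrite big1_seq ?(eq_sym 0) ?oner_neq0 // => v /andP[_]; rewrite mem_undup => vl.
  by apply/eqP/negPn/negP => xv; apply: (h v); rewrite mem_filter xv.
split=> //.
- apply: spans_simplexS sl _; first by move=> v; rewrite mem_filter => /andP[].
  by case: ex => v vin e; rewrite e in vin.
- move=> v; rewrite !inE mem_filter; apply/andb_idr.
  by apply: contraNT => /xl ->.
- rewrite -x1; apply/esym/sum_in_simplex; rewrite ?undup_uniq ?fset_uniq //.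
    by move=> v; rewrite !inE mem_filter mem_undup => /andP[].
  move=> v; rewrite !inE mem_filter negb_and negbK => /orP[/eqP//|/xl//].
Qed.

Definition point (x0 : realization R X) x : realization R X :=
  xget x0 [set p | Defs.coord p = x].

Lemma coord_point (x0 : realization R X) l x : spans_simplex l -> in_simplex l x ->
  Defs.coord (point x0 x) = x.
Proof.
move=> sl xl; rewrite /point; case: xgetP => [p _ //|/(_ (Realization (in_simplex_barycentric _ _ sl xl)))].
by move=> /(_ erefl).
Qed.

Lemma seq_pos_choice {T : eqType} (L : seq T) (P : T -> R -> Prop) :
  (forall k, k \in L -> exists2 e, 0 < e & P k e) ->
  (forall k d e, 0 < d -> d <= e -> P k e -> P k d) ->
  exists2 e, 0 < e & forall k, k \in L -> P k e.
Proof.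
move=> LP Pmono; elim: L LP => [|k L IH] LP; first by exists 1.
have [e e0 eL] := IH (fun m mL => LP m (mem_behead (s := k :: L) mL)).
have [d d0 dl] := LP k (mem_head _ _).
exists (Num.min d e); first by rewrite lt_min d0.
move=> m; rewrite inE => /predU1P[->|mL].
  by apply: Pmono dl; rewrite ?lt_min ?d0 // ge_min lexx.
by apply: Pmono (eL m mL); rewrite ?lt_min ?d0 // ge_min lexx orbT.
Qed.

Definition polyhedron (L : seq (seq (vertex X))) x : Prop :=
  exists2 l, l \in L & in_simplex l x.

(** On a finite union of simplices the weak topology is no finer than the sup metric. A simplex
    containing [x] gives a radius by definition of the topology; any other stays away from [x] by a
    nonzero coordinate of [x] outside it. The smallest of these radii serves. *)
Lemma open_ball_polyhedron (x0 : realization R X) (L : seq (seq (vertex X))) (U : set (realization R X)) x :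
  (forall l, l \in L -> spans_simplex l) -> open U -> U (point x0 x) ->
  polyhedron L x ->
  exists2 e, 0 < e & forall y, polyhedron L y -> (forall v, `|x v - y v| < e) ->
    U (point x0 y).
Proof.
move=> Lsp oU Ux [l0 l0L xl0].
have [l lL|l d e d0 de Pe y yl xy|e e0 eL] := seq_pos_choice L (fun l e => forall y,
    in_simplex l y -> (forall v, `|x v - y v| < e) -> U (point x0 y)).
- have [xl|] := pselect (forall v, x v != 0 -> v \in l); last first.
    move=> /existsNP[v /not_implyP[xv /negP vl]].
    exists `|x v|; first by rewrite normr_gt0.
    by move=> y [_ yl _] /(_ v); rewrite yl // subr0 ltxx.
  have {}xl : in_simplex l x by exact: in_simplex_supp xl0 xl.
  have l0' : l <> [::].
    by move=> l0'; move: xl => [_ _ /eqP]; rewrite l0' big_nil eq_sym oner_eq0.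
  have cx := coord_point x0 _ _ (Lsp _ lL) xl.
  have [|e e0 eU] := oU _ (Lsp l lL l0') (point x0 x) _ Ux.
    by move=> v; rewrite cx inE; apply: contraNT; case: xl => _ xl _ /xl ->.
  exists e => // y yl xy; apply: eU.
    move=> v; rewrite (coord_point x0 _ _ (Lsp _ lL) yl) inE.
    by apply: contraNT; case: yl => _ yl _ /yl ->.
  by move=> v _; rewrite cx (coord_point x0 _ _ (Lsp _ lL) yl).
- by apply: Pe => // v; exact: lt_le_trans (xy v) de.
- by exists e => // y [l lL yl]; exact: eL lL _ yl.
Qed.

End Geometry.

(** * A Lebesgue number for the cover by preimages of open stars *)

Section Lebesgue.
Context {R : realType} {X : simplicial_complex}.

Lemma open_star (v : vertex X) : open [set q : realization R X | q v != 0].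
Proof.
move=> s _ q qs qv; exists `|q v|; first by rewrite normr_gt0.
move=> q' _ /(_ v (qs v qv)) qq'; apply/negP => /eqP q'v.
by move: qq'; rewrite q'v subr0 ltxx.
Qed.

Variables (x0 : realization R X) (H : realization R X * R -> realization R X).
Hypothesis Hcont : {within [set: realization R X] `*` `[0, 1], continuous H}.
Variable L : seq (seq (vertex X)).
Hypothesis Lspans : forall l, l \in L -> spans_simplex l.

(** A nonzero coordinate at [v] means lying in the open star of [v]. *)
Definition star_ball (x : vertex X -> R) (t d : R) (v : vertex X) : Prop :=
  forall y u, polyhedron L y -> 0 <= u <= 1 ->
    (forall w, `|x w - y w| < d) -> `|t - u| < d ->
    H (point x0 y, u) v != 0.

Lemma star_ball_local (x : vertex X -> R) t : polyhedron L x -> 0 <= t <= 1 ->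
  exists2 e, 0 < e & exists v, star_ball x t e v.
Proof.
move=> Lx t01.
(* Any vertex of the carrier of the image point will do, because its open star is an open
   neighbourhood of that point. *)
have [s [ss _ sE s1]] := coordP (H (point x0 x, t)).
have /fset0Pn[v] : s != fset0 := simplex_neq0 ss.
rewrite sE => vs.
move/subspace_continuousP: Hcont => /(_ (point x0 x, t)).
have Ht : ([set: realization R X] `*` `[0, 1]) (point x0 x, t).
  by split => //=; rewrite in_itv.
move=> /(_ Ht) /(_ [set q : realization R X | q v != 0]).
move=> /(_ (open_nbhs_nbhs (conj (open_star v) vs))).
rewrite /= nbhs_simpl /within /= => -[[U W] /= [Ux Wt] UW].
have [e e0 eU] : exists2 e : R, 0 < e & forall y, polyhedron L y ->
    (forall v, `|x v - y v| < e) -> U (point x0 y).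
  move: Ux; rewrite nbhsE => -[U' [oU' U'x] U'U].
  have [e e0 eU] := open_ball_polyhedron x0 L U' x Lspans oU' U'x Lx.
  by exists e => // y yL xy; exact/U'U/eU.
move/nbhs_ballP: Wt => [d /= d0 dW].
exists (Num.min e d); first by rewrite lt_min e0.
exists v => y u yL u01 xy tu.
apply: (UW (point x0 y, u)).
  split => /=.
    by apply: eU => // w; have := xy w; rewrite lt_min => /andP[].
  by apply: dW; move: tu; rewrite lt_min => /andP[].
by split => //=; rewrite in_itv.
Qed.

Lemma continuous_sum_coords {V : choiceType} (s : seq V) :
 continuous (fun y : prod_topology (fun _ : V => R) => \sum_(v <- s) y v).
Proof.
elim: s => [|v s IH].
  have -> : (fun y : prod_topology (fun _ : V => R) => \sum_(v <- [::]) y v) = (fun=> 0).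
    by apply/funext => y; rewrite big_nil.
  exact: cst_continuous.
have -> : (fun y : prod_topology (fun _ : V => R) => \sum_(w <- v :: s) y w) =
   (fun y => y v + \sum_(w <- s) y w).
  by apply/funext => y; rewrite big_cons.
move=> x.
apply: (@continuousD R R^o _ (fun y : prod_topology (fun _ : V => R) => y v)
  (fun y => \sum_(w <- s) y w)); last exact: IH.
exact: (@proj_continuous _ (fun _ : V => R) v x).
Qed.

(** A closed condition inside a product of segments and points: the coordinates outside [l] are
    confined to [0], and Tychonoff's theorem applies to all vertices at once. *)
Lemma compact_in_simplex (l : seq (vertex X)) :
  compact ([set x : prod_topology (fun _ : vertex X => R) | in_simplex l x]).
Proof.
pose A v : set R := if v \in l then `[0, 1]%classic else [set 0].
have cA : compact [set x : prod_topology (fun _ : vertex X => R) | forall v, A v (x v)].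
  apply: tychonoff => v; rewrite /A; case: ifP => _; last exact: compact_set1.
  exact: segment_compact.
have cl : closed [set x : prod_topology (fun _ : vertex X => R) |
    \sum_(v <- undup l) x v = 1].
  apply: (@preimage_closed _ _ (fun x : prod_topology (fun _ : vertex X => R) =>
    \sum_(v <- undup l) x v) [set 1]); last exact: closed_eq.
  by move=> x _; exact: continuous_sum_coords.
rewrite [X in compact X](_ : _ = [set x : prod_topology (fun _ : vertex X => R) |
    forall v, A v (x v)] `&` [set x | \sum_(v <- undup l) x v = 1]); last first.
  apply/seteqP; split => [x xl|x [xA x1]] /=.
    split; last by case: xl.
    move=> v; rewrite /A; case: ifPn => [_|vl]; last by case: xl => _ /(_ v vl) ->.
    by rewrite /= in_itv /= (in_simplex_le1 _ _ _ xl) andbT; case: xl.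
  split=> // v => [|/negPf vl]; last by have := xA v; rewrite /A vl.
  by have := xA v; rewrite /A; case: ifP => _ /= => [|->//]; rewrite in_itv => /andP[].
exact: compact_closedI.
Qed.

(** Product neighbourhoods control finitely many coordinates, which suffices on the simplex [l],
    whose points vanish outside [l]. *)
Lemma near_coords (l : seq (vertex X)) (x : prod_topology (fun _ : vertex X => R)) (e : R) :
  0 < e -> nbhs x [set y | forall v, v \in l -> `|x v - y v| < e].
Proof.
move=> e0; elim: l => [|v l IH].
  rewrite (_ : [set y | _] = setT); first exact: (@filterT _ _ (nbhs_filter x)).
  by apply/seteqP; split=> // y _ w; rewrite in_nil.
have xv : nbhs x [set y | ball (x v) e (y v)].
  by apply: (@proj_continuous _ (fun _ : vertex X => R) v x); exact: nbhsx_ballx.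
apply: (@filterS _ _ (nbhs_filter x) _ _ _ (@filterI _ _ (nbhs_filter x) _ _ xv IH)).
move=> y [yv yl] w; rewrite inE => /predU1P[->|]; last exact: yl.
exact: yv.
Qed.

Lemma lebesgue_number : exists2 d : R, 0 < d &
  forall x t, polyhedron L x -> 0 <= t <= 1 -> exists v, star_ball x t d v.
Proof.
have [l lL|l e d e0 de h x t xl t01|d d0 dL] := seq_pos_choice L (fun l d => forall x t,
    in_simplex l x -> 0 <= t <= 1 -> exists v, star_ball x t d v).
- have cK := compact_setX (compact_in_simplex l) (@segment_compact R 0 1).
  have /near_covering_withinP/(_ _ (0 : R)^'+ (fun d xt => exists v, star_ball xt.1 xt.2 d v)) :=
    (compact_near_coveringP _).1 cK.
  have near_e : forall x : prod_topology (fun _ : vertex X => R) * R,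
      ([set x | in_simplex l x] `*` `[0, 1]) x -> \forall x' \near x & d \near (0 : R)^'+,
      ([set x | in_simplex l x] `*` `[0, 1]) x' -> exists v, star_ball x'.1 x'.2 d v.
    move=> [x t] [/= xl]; rewrite in_itv => t01.
    have [e e0 [v xv]] := star_ball_local x t (ex_intro2 _ _ l lL xl) t01.
    (* Half the radius: a ball of radius less than [e / 2] about a point within [e / 2] of [(x, t)]
       stays within [e] of [(x, t)]. *)
    have e2 : 0 < e / 2 by rewrite divr_gt0.
    exists ([set xt | (forall v, v \in l -> `|x v - xt.1 v| < e / 2) /\ `|t - xt.2| < e / 2],
        [set d | d < e / 2]).
      split; last exact: nbhs_right_lt.
      exists ([set y | forall v, v \in l -> `|x v - y v| < e / 2], ball t (e / 2)).
        by split; [exact: near_coords|exact: nbhsx_ballx].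
      by case=> y u [].
    move=> [[y u] d] /= [[xy tu] de] [/= yl u01]; exists v => z r zL r01 yz ur.
    apply: xv => // [w|].
      rewrite -(subrK (y w) (x w)) -addrA (splitr e) (le_lt_trans (ler_normD _ _)) //.
      rewrite ltrD ?(lt_trans (yz w)) //.
      have [/xy//|wl] := boolP (w \in l).
      by case: xl yl => _ /(_ w wl) -> _ [_ /(_ w wl) -> _]; rewrite subrr normr0.
    rewrite -(subrK u t) -addrA (splitr e) (le_lt_trans (ler_normD _ _)) //.
    by rewrite ltrD // (lt_trans ur).
  move=> /(_ _ near_e) hd.
  have [d [d0 dh]] := filter_ex (filterI (nbhs_right_gt (0 : R)) hd).
  exists d => // x t xl t01; apply: (dh (x, t)); split => //=.
- have [v xv] := h x t xl t01; exists v => y u yL u01 xy tu; apply: xv => //.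
    by move=> w; exact: lt_le_trans (xy w) de.
  exact: lt_le_trans tu de.
- by exists d => // x t [l lL xl] t01; exact: dL lL x t xl t01.
Qed.

End Lebesgue.

(** * Acyclicity of contractible complexes *)

Section Acyclicity.
Context {E : zmodType} {R : realType} {X : simplicial_complex}.
Local Notation span := (@span E _).
Local Notation codiff := (@codiff E _).

(** A chain lives on finitely many simplices, and the Lebesgue number is taken for the polyhedron
    that they form. *)
Lemma span_finite {V : eqType} (P : seq V -> Prop) (z : chain V) : span P z ->
  exists2 L : seq (seq V), forall l, l \in L -> P l &
    span (fun s => s \in L /\ P s) z.
Proof.
elim=> [|F G _ [L LP LF] _ [M MP MG]|s Ps].
- by exists [::] => //; exact: span_zero.
- exists (L ++ M); first by move=> l; rewrite mem_cat => /orP[/LP|/MP].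
  apply: span_sub; [apply: span_mono LF|apply: span_mono MG] => s [sL Ps];
    by rewrite mem_cat sL ?orbT.
- exists [:: s]; first by move=> l; rewrite inE => /eqP ->.
  by apply: (span_gen _ s); rewrite inE.
Qed.

Definition small_in_simplex (d : R) (l : seq (vertex X)) (p : seq (vertex X -> R)) :
    Prop :=
  (forall x, x \in p -> in_simplex l x) /\
  (forall x y, x \in p -> y \in p -> forall v, `|x v - y v| < d).

(* Contract the simplex onto its first vertex in steps of size less than [d]. *)
Lemma small_in_simplex_acyclic (d : R) (l : seq (vertex X)) (k : nat)
    (z : chain (vertex X -> R)) : 0 < d -> l <> [::] ->
  span (fun p => small_in_simplex d l p /\ size p = k) z ->
  (forall f, z (codiff f) = 0) ->
  exists w, span (fun p => small_in_simplex (2 * d) l p /\ size p = k.+1) w /\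
    forall f, w (codiff f) = z f.
Proof.
move=> d0; case: l => // b l _; set bl := b :: l => Pz z0.
pose B : vertex X -> R := fun v => (v == b)%:R.
have Bin : in_simplex bl B by apply: in_simplex_vertex; exact: mem_head.
pose M := Num.bound d^-1.
have dM : d^-1 < M%:R by apply: archi_boundP; rewrite invr_ge0 ltW.
have M0 : 0 < M%:R :> R by apply: lt_trans dM; rewrite invr_gt0.
have Md : M%:R^-1 < d by rewrite invf_plt ?posrE.
pose a (j : nat) (x : vertex X -> R) v := (1 - j%:R / M%:R) * x v + j%:R / M%:R * B v.
have a0 : a 0%N = id.
  by apply/funext => x; apply/funext => v; rewrite /a !mul0r subr0 mul1r addr0.
have aM : a M = fun=> B.
  apply/funext => x; apply/funext => v.
  by rewrite /a divff ?gt_eqF // subrr mul0r add0r mul1r.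
have unit_j j : (j <= M)%N -> 0 <= j%:R / M%:R :> R /\ j%:R / M%:R <= 1 :> R.
  by move=> jM; rewrite divr_ge0 ?ler0n // ler_pdivrMr // mul1r ler_nat.
have a_in j x : (j <= M)%N -> in_simplex bl x -> in_simplex bl (a j x).
  by move=> jM xl; apply: in_simplex_convex => //; apply/andP; exact: unit_j.
have a_dist i j x y v : (i <= M)%N -> (j <= M)%N -> (i <= j.+1)%N -> (j <= i.+1)%N ->
    in_simplex bl y -> `|x v - y v| < d -> `|a i x v - a j y v| < 2 * d.
  move=> iM jM ij ji yl xy.
  (* The first term is the old distance, not enlarged; the second is at most [1 / M < d] because [i]
     and [j] differ by at most one. Hence the doubled scale. *)
  have -> : a i x v - a j y v = (1 - i%:R / M%:R) * (x v - y v) +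
      (j%:R - i%:R) / M%:R * (y v - B v) by rewrite /a; field; rewrite gt_eqF.
  rewrite [2 * d]mulr_natl mulr2n (le_lt_trans (ler_normD _ _)) // ltrD //.
    rewrite normrM (le_lt_trans _ xy) // ler_piMl // ler_norml.
    by have [h1 h2] := unit_j i iM; apply/andP; split; lra.
  rewrite normrM (le_lt_trans _ Md) // -[leRHS]mulr1 ler_pM //.
    rewrite normrM (gtr0_norm (_ : 0 < M%:R^-1)) ?invr_gt0 // ler_piMl ?invr_ge0 ?(ltW M0) //.
    rewrite ler_norml; move: ij ji; rewrite -(ler_nat R) -[(j <= _)%N](ler_nat R).
    by rewrite -!natr1 => h1 h2; apply/andP; split; lra.
  have yv := in_simplex_le1 _ _ v yl; have Bv := in_simplex_le1 _ _ v Bin.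
  have yv0 : 0 <= y v by case: yl.
  have Bv0 : 0 <= B v by exact: ler0n.
  by rewrite ler_norml; apply/andP; split; lra.
have [|w [Qw wE]] := homotopic_chains a M z _
    (fun p => small_in_simplex (2 * d) bl p /\ size p = k.+1) Pz z0.
  move=> j jM s [[sl sd] sk] t st ts; split; last by rewrite st sk.
  have tE x : x \in t -> exists i y, [/\ (j <= i <= j.+1)%N, y \in s & x = a i y].
    move=> /ts; rewrite mem_cat => /orP[] /mapP[y ys ->].
      by exists j, y; rewrite leqnn leqnSn.
    by exists j.+1, y; rewrite leqnn leqnSn.
  split=> [x /tE[i [y [/andP[ji ij] ys ->]]]|].
    by apply: a_in; [exact: leq_trans ij jM|exact: sl].
  move=> x x' /tE[i [y [/andP[ji ij] ys ->]]] /tE[i' [y' [/andP[ji' ij'] ys' ->]]] v.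
  apply: a_dist; rewrite ?(leq_trans ij jM) ?(leq_trans ij' jM) //.
  - exact: leq_trans ij _.
  - exact: leq_trans ij' _.
  - exact: sl.
  - exact: sd.
have zM : span (fun p => small_in_simplex (2 * d) bl (B :: p) /\ size p = k)
    (fun f => z (fun s => f (map (a M) s))).
  apply: (span_map _ _ (map (a M)) _ _ Pz) => s [_ sk]; rewrite size_map; split=> //.
  have BE x : x \in B :: map (a M) s -> x = B.
    by rewrite inE => /predU1P[//|/mapP[y _ ->]]; rewrite aM.
  split=> [x /BE ->//|x y /BE -> /BE -> v]; rewrite subrr normr0.
  by rewrite mulr_gt0.
(* After [M] steps all points are [B], and the resulting cycle is filled by its cone from [B];
   subtracting [w] carries this filling back to [z]. *)
exists (fun f => cone B (fun f => z (fun s => f (map (a M) s))) f - w f); split.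
  apply: span_sub => //; apply: (span_map _ _ (cons B) _ _ zM).
  by move=> p [? <-].
move=> f; rewrite (cone_codiff _ _ _ _ zM) wE a0.
have -> : (fun s : seq (vertex X -> R) => f (map id s)) = f.
  by apply/funext => s; rewrite map_id.
have -> : (fun s : seq (vertex X -> R) => codiff (fun t => f (B :: t)) (map (a M) s)) =
    codiff (fun t => f (B :: map (a M) t)).
  by apply/funext => s; rewrite codiff_map.
by rewrite z0 subr0 opprB addrC subrK.
Qed.

Lemma contractible_acyclic (k : nat) (z : chain (vertex X)) :
  contractible R (realization R X) ->
  span (fun s => spans_simplex s /\ size s = k) z ->
  (forall f, z (codiff f) = 0) ->
  exists w, span (fun s => spans_simplex s /\ size s = k.+1) w /\
    forall f, w (codiff f) = z f.
Proof.
move=> [c [H [Hcont H0 H1]]] /span_finite[L LP zL] z0.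
have Lsp l : l \in L -> spans_simplex l by move=> /LP[].
have [d d0 dH] := lebesgue_number c H Hcont L Lsp.
have [cs [css _ csE _]] := coordP c.
have /fset0Pn[v0 v0c] := simplex_neq0 css.
(* Vertices whose open stars share the point [q] all belong to the carrier of [q]. *)
have star_simplex (q : realization R X) p :
    (forall v, v \in p -> q v != 0) -> spans_simplex p.
  move=> qp p0; have [s [ss _ sE _]] := coordP q.
  apply: simplexS ss _ _; first by apply/fsubsetP => v; rewrite inE sE; exact: qp.
  by case: p p0 {qp} => // v p _; apply/fset0Pn; exists v; rewrite !inE eqxx.
pose a (t : R) x := xget v0 [set v : vertex X | star_ball c H L x t d v].
have aP x t : polyhedron L x -> 0 <= t <= 1 -> star_ball c H L x t d (a t x).
  by move=> xL t01; exact: (xgetPex v0 (dH x t xL t01)).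
pose M := Num.bound d^-1.
have dM : d^-1 < M%:R by apply: archi_boundP; rewrite invr_ge0 ltW.
have M0 : 0 < M%:R :> R by apply: lt_trans dM; rewrite invr_gt0.
have Md : M%:R^-1 < d by rewrite invf_plt ?posrE.
have unit_j (j : nat) : (j <= M)%N -> 0 <= (j%:R / M%:R : R) <= 1.
  by move=> jM; rewrite divr_ge0 ?ler0n //= ler_pdivrMr // mul1r ler_nat.
pose A (j : nat) := a (j%:R / M%:R).
pose Q (s : seq (vertex X)) := exists2 l, l \in L & {subset s <= l}.
have Qface s t : Q s -> is_face t s -> Q t.
  by move=> [l lL sl] /is_face_sub ts; exists l => // v /ts /sl.
have Qpoly s (x : vertex X -> R) : Q s -> in_simplex s x -> polyhedron L x.
  by move=> [l lL sl] xs; exists l => //; exact: in_simplexS xs.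
(* Filling doubles the scale, so a simplex with [j] vertices is filled at scale
   [eta * 2 ^+ j], which is [d] for [j = k]. *)
pose eta := d / 2 ^+ k.
have eta0 n : 0 < eta * 2 ^+ n by rewrite mulr_gt0 ?divr_gt0 ?exprn_gt0.
pose Phi s p := small_in_simplex (eta * 2 ^+ size s) s p /\ size p = size s.
pose fill s (y : chain (vertex X -> R)) : chain (vertex X -> R) :=
  xget (fun=> 0) [set w | span (Phi s) w /\ forall f, w (codiff f) = y f].
(* [T] takes the place of iterated subdivision: each simplex becomes a chain of tight tuples of its
   points, compatibly with boundaries. *)
pose T := extend (fun f => f [::]) fill.
have TP : forall s, Q s -> span (Phi s) (T s) /\
    forall f, T s (codiff f) = codiff (fun t => T t f) s.
  apply: extend_chain_map => //.
  move=> [//|v s] Qs s0 Py y0; rewrite /T extendE // -/T.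
  have Py' : span (fun p => small_in_simplex (eta * 2 ^+ size s) (v :: s) p /\
      size p = size s) (fun f => codiff (fun t => T t f) (v :: s)).
    apply: span_mono Py => p [t ts [[tp td] tk]].
    have [st] := is_face_size _ _ ts; rewrite st; split=> //; split=> // x /tp.
    by apply: in_simplexS; exact: is_face_sub.
  have [w [Pw wE]] := small_in_simplex_acyclic _ _ _ _ (eta0 (size s)) s0 Py' y0.
  have ex : exists w, [set w | span (Phi (v :: s)) w /\
      forall f, w (codiff f) = codiff (fun t => T t f) (v :: s)] w.
    exists w; split=> //; apply: span_mono Pw => p.
    by rewrite /Phi /= mulrCA -exprS.
  exact: (xgetPex (fun=> 0) ex).
pose zT : chain (vertex X -> R) := fun f => z (fun s => T s f).
have PzT : span (fun p => (exists2 l, l \in L & small_in_simplex d l p) /\ size p = k) zT.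
  apply: (span_bind _ _ _ T zL) => s [sL [_ sk]].
  have Qs : Q s by exists s.
  apply: span_mono (TP s Qs).1 => p; rewrite /Phi sk => -[sp ->]; split=> //.
  by exists s => //; move: sp; rewrite /eta divfK // gt_eqF // exprn_gt0.
have zT0 f : zT (codiff f) = 0.
  rewrite -(z0 (fun t => T t f)); apply: (eq_span _ _ _ _ zL) => s [sL _].
  by apply: (TP s _).2; exists s.
have [|w1 [Pw1 w1E]] := homotopic_chains A M zT _
    (fun s => spans_simplex s /\ size s = k.+1) PzT zT0.
  move=> j jM p [[l lL [pl pd]] pk] t tk ts; split; last by rewrite tk pk.
  case: p pl pd pk tk ts => [|x p] pl pd pk tk ts.
    by case: t tk ts => [|v t] //= _ /(_ v (mem_head _ _)); rewrite in_nil.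
  (* The common point of the stars is the image of the first point [x] of [p] at time [j / M]: the
     other points are within [d] of [x], and the two times differ by less than [d]. *)
  apply: (star_simplex (H (point c x, j%:R / M%:R))) => v /ts.
  have step y i : y \in x :: p -> (j <= i <= j.+1)%N -> H (point c x, j%:R / M%:R) (A i y) != 0.
    move=> yp /andP[ji ij]; apply: aP => //.
    - by exists l => //; exact: pl.
    - exact/unit_j/(leq_trans ij).
    - by exists l => //; apply: pl; exact: mem_head.
    - exact/unit_j/ltnW.
    - by move=> w; apply: pd => //; exact: mem_head.
    - rewrite -mulrBl normrM (gtr0_norm (_ : 0 < M%:R^-1)) ?invr_gt0 //.
      rewrite (le_lt_trans _ Md) // ler_piMl ?invr_ge0 ?(ltW M0) // ler_norml.
      move: ji ij; rewrite -(ler_nat R) -[(i <= _)%N](ler_nat R) -!natr1 => h1 h2.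
      by apply/andP; split; lra.
  by rewrite mem_cat => /orP[] /mapP[y yp ->]; apply: step; rewrite ?leqnn ?leqnSn.
(* At time 1 the contraction is constant at [c], so the chosen vertices lie in the carrier of [c]
   together with [v0], which can serve as a cone point. *)
have zM : span (fun s => spans_simplex (v0 :: s) /\ size s = k)
    (fun f => zT (fun p => f (map (A M) p))).
  apply: (span_map _ _ (map (A M)) _ _ PzT) => p [[l lL [pl _]] pk].
  rewrite size_map; split=> //; apply: (star_simplex c) => v.
  rewrite inE => /predU1P[->|/mapP[x xp ->]]; first by rewrite -csE.
  have Lx : polyhedron L x by exists l => //; exact: pl.
  have M1 : M%:R / M%:R = 1 :> R by rewrite divff ?gt_eqF.
  rewrite -(H1 (point c x)) /A M1; apply: aP => //; rewrite ?ler01 ?lexx //.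
    by move=> w; rewrite subrr normr0.
  by rewrite subrr normr0.
pose w2 : chain (vertex X) := cone v0 (fun f => zT (fun p => f (map (A M) p))).
have Pw2 : span (fun s => spans_simplex s /\ size s = k.+1) w2.
  by apply: (span_map _ _ (cons v0) _ _ zM) => s [? <-].
have w2E f : w2 (codiff f) = zT (fun p => f (map (A M) p)).
  rewrite /w2 (cone_codiff _ _ _ _ zM).
  rewrite [X in _ - X](_ : _ = zT (codiff (fun p => f (v0 :: map (A M) p)))).
    by rewrite zT0 subr0.
  by congr zT; apply/funext => p; rewrite codiff_map.
(* At time 0 the contraction is the identity, so a point of [s] is sent to a vertex of [s]. Thus
   [phi] stays within each simplex, and cones there join it to the identity. *)
pose phi s : chain (vertex X) := fun f => T s (fun p => f (map (A 0%N) p)).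
have Pphi s : Q s -> span (fun t => size t = size s /\ {subset t <= s}) (phi s).
  move=> Qs; apply: (span_map _ _ (map (A 0%N)) _ _ (TP s Qs).1) => p [[ps _] psz].
  rewrite size_map; split=> // _ /mapP[x xp ->].
  have xs := ps x xp; have Lx := Qpoly _ _ Qs xs.
  have : H (point c x, 0) (A 0%N x) != 0.
    rewrite /A mul0r; apply: aP => //; rewrite ?ler01 ?lexx //.
      by move=> w; rewrite subrr normr0.
    by rewrite subrr normr0.
  have [l lL sl] := Qs.
  rewrite H0 (coord_point c l _ (Lsp l lL) (in_simplexS _ _ _ sl xs)).
  by apply: contraNT; case: xs => _ xs0 _ /xs0 ->.
have phi_chain s f : Q s -> phi s (codiff f) = codiff (fun t => phi t f) s.
  move=> Qs; rewrite /phi -(TP s Qs).2.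
  by congr (T s); apply/funext => p; rewrite codiff_map.
pose h := cone_homotopy phi.
have Ph s : Q s -> span (fun t => size t = (size s).+1 /\ {subset t <= s}) (h s).
  apply: (span_cone_homotopy _ _ (fun s t => size t = (size s).+1 /\ {subset t <= s}) Qface).
  - move=> x t Qt; apply: span_mono (Pphi _ Qt) => u [su ut].
    split; first by rewrite /= su.
    by move=> v; rewrite inE => /predU1P[->|/ut//]; exact: mem_head.
  - by move=> x t _; split=> // v; rewrite inE => /predU1P[->|//]; exact: mem_head.
  - move=> x t u p _ ut [pu pus]; split; first by have [st] := is_face_size _ _ ut; rewrite /= pu st.
    move=> v; rewrite inE => /predU1P[->|/pus]; first exact: mem_head.
    exact: (is_face_sub _ _ ut).
have hE s f : Q s -> h s (codiff f) = phi s f - f s - codiff (fun t => h t f) s.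
  by apply: (cone_homotopy_codiff _ Q _ Qface _ Pphi) => // *; exact: phi_chain.
pose w3 : chain (vertex X) := fun f => z (fun s => h s f).
have Pw3 : span (fun s => spans_simplex s /\ size s = k.+1) w3.
  apply: (span_bind _ _ _ h zL) => s [sL [ss sk]].
  have Qs : Q s by exists s.
  apply: span_mono (Ph s Qs) => t [tk ts]; split; last by rewrite tk sk.
  exact: spans_simplexS ts ss.
(* [w2] fills the cycle at time 1, [w1] joins time 0 to time 1, and [w3] joins [z] to its image at
   time 0. *)
exists (fun f => w2 f - w1 f - w3 f); split; first by do 2 apply: span_sub => //.
move=> f; rewrite w2E w1E.
have -> : w3 (codiff f) = zT (fun p => f (map (A 0%N) p)) - z f - z (codiff (fun t => h t f)).
  rewrite /zT /w3 -(spanBf _ _ _ _ zL) -(spanBf _ _ _ _ zL).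
  by apply: (eq_span _ _ _ _ zL) => s [sL _]; apply: hE; exists s.
rewrite z0; by cancel_terms.
Qed.
End Acyclicity.

(** * Group cohomology and simplicial cochains *)

Section GroupCohomology.
Context {Gamma : groupType} {K : numFieldType} {E : normedModType K}.
Implicit Types rho : representation Gamma E.

Definition equivariant {W : Type} (a : Gamma -> W -> W) rho (f : seq W -> E) : Prop :=
  forall g s, f (map (a g) s) = rho g (f s).

(** Exactness at lists of size [n.+1], tested on [P] while cochains remain total functions. As the
    empty list is included, [n = 0] gives the augmented condition rather than the vanishing of
    [H^0]. *)
Definition vanishes {W : Type} (a : Gamma -> W -> W) (P : seq W -> Prop) rho
    (n : nat) : Prop :=
  forall f, equivariant a rho f ->
    (forall s, P s -> size s = n.+2 -> codiff f s = 0) ->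
    exists2 h, equivariant a rho h &
      forall s, P s -> size s = n.+1 -> f s = codiff h s.

Lemma equivariantE {W : Type} (a : Gamma -> W -> W) rho (f : seq W -> E) g :
  equivariant a rho f -> (fun s => f (map (a g) s)) = fun s => rho g (f s).
Proof. by move=> fe; apply/funext => s; exact: fe. Qed.

Lemma equivariant_codiff {W : Type} (a : Gamma -> W -> W) rho (f : seq W -> E) :
  equivariant a rho f -> equivariant a rho (codiff f).
Proof.
move=> fe g s; rewrite codiff_map (equivariantE _ _ _ _ fe).
by apply: codiff_additive => x y; exact: raddfB.
Qed.

Lemma equivariantB {W : Type} (a : Gamma -> W -> W) rho (f h : seq W -> E) :
  equivariant a rho f -> equivariant a rho h ->
  equivariant a rho (fun s => f s - h s).
Proof. by move=> fe he g s; rewrite fe he raddfB. Qed.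

Lemma equivariant_pullback {W W' : Type} (a : Gamma -> W -> W) (a' : Gamma -> W' -> W')
    rho (T : seq W -> chain W') (f : seq W' -> E) :
  (forall g s f', T (map (a g) s) f' = T s (fun t => f' (map (a' g) t))) ->
  (forall s, span (fun=> True) (T s)) ->
  equivariant a' rho f -> equivariant a rho (fun s => T s f).
Proof.
move=> Te Ts fe g s; rewrite Te (equivariantE _ _ _ _ fe).
by apply: span_additive (Ts s) => x y; exact: raddfB.
Qed.

(** All tuples being allowed, the prism is an equivariant homotopy from the identity to [i \o u]. So
    a cocycle differs by a coboundary from its pullback along [i \o u], which factors through
    [V]. *)
Lemma vanishes_transfer {V W : Type} (a : Gamma -> V -> V) (b : Gamma -> W -> W)
    (i : V -> W) (u : W -> V) rho n :
  (forall g v, i (a g v) = b g (i v)) -> (forall g w, u (b g w) = a g (u w)) ->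
  vanishes a (fun=> True) rho n -> vanishes b (fun=> True) rho n.
Proof.
move=> ia ub van f fe f0.
have [||h he hE] := van (fun s => f (map i s)).
- by move=> g s; rewrite -fe -!map_comp; congr f; apply: eq_map => v /=.
- by move=> s _ sn; rewrite -codiff_map f0 // size_map.
exists (fun s => h (map u s) - prism id (i \o u) s f).
  apply: equivariantB.
    by move=> g s; rewrite -he -!map_comp; congr h; apply: eq_map => v /=.
  apply: (equivariant_pullback b b) => //.
    by move=> g s f'; apply: prism_map => // x; rewrite /= ub ia.
  by move=> s; apply: span_mono (@span_prism E _ {classic W} _ _ _).
move=> s _ sn; have := prism_codiff id (i \o u) f s.
rewrite (span0f _ _ _ (@span_prism E _ {classic W} _ _ _)); last first.
  by move=> t [st _]; apply: f0 => //; rewrite st sn.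
rewrite codiffB map_id -codiff_map -hE ?size_map // -map_comp => /esym/eqP.
by rewrite subr_eq0 subr_eq addrC -subr_eq => /eqP ->.
Qed.

Lemma codom_ordS {W : Type} (n : nat) (x : 'I_n.+1 -> W) :
  codom x = x ord0 :: codom (x \o lift ord0).
Proof. by rewrite /codom /image_mem enum_ordSl /= -map_comp. Qed.

Lemma codiff_codom {W : Type} (n : nat) (f : seq W -> E) (x : 'I_n.+1 -> W) :
  codiff f (codom x) = \sum_(i < n.+1) (-1) ^+ i *: f (codom (x \o lift i)).
Proof.
elim: n f x => [|n IH] f x; rewrite codom_ordS /=.
  rewrite big_ord1 expr0 scale1r /codom /image_mem.
  by rewrite !(size0nil (size_enum_ord 0)) /= subr0.
rewrite big_ord_recl expr0 scale1r IH; congr (_ + _).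
rewrite -sumrN; apply: eq_bigr => i _.
rewrite lift0 exprS mulN1r scaleNr; congr (- (_ *: f _)).
rewrite [in RHS]codom_ordS; congr (x _ :: _); first exact/val_inj.
apply: eq_map => j /=; congr (x _); apply/val_inj => /=.
by rewrite /bump !leq0n !add1n ltnS addnS.
Qed.

Lemma codom_map {V W : Type} {n : nat} (g : V -> W) (x : 'I_n -> V) :
  codom (fun i => g (x i)) = map g (codom x).
Proof. by rewrite /codom /image_mem -map_comp. Qed.

Lemma nth_codom {n : nat} (w : Gamma) (x : 'I_n -> Gamma) :
  (fun i : 'I_n => nth w (codom x) i) = x.
Proof.
apply/funext => i; rewrite /codom /image_mem (nth_map i) ?size_enum_ord //.
by rewrite nth_ord_enum.
Qed.

Lemma codom_nth {n : nat} (w : Gamma) (s : seq Gamma) : size s = n ->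
  codom (fun i : 'I_n => nth w s i) = s.
Proof.
move=> <-; rewrite /codom /image_mem -[RHS](mkseq_nth w) /mkseq -val_enum_ord -map_comp.
by apply: eq_map.
Qed.

Definition seq_cochain {n} (f : ('I_n -> Gamma) -> E) (s : seq Gamma) : E :=
  if size s == n then f (fun i => nth 1%g s i) else 0.

Lemma seq_cochain_equivariant rho n (f : ('I_n.+1 -> Gamma) -> E) :
  cochain rho f -> equivariant (fun g h => g * h)%g rho (seq_cochain f).
Proof.
move=> fc g s; rewrite /seq_cochain size_map; case: eqP => [sn|_]; last by rewrite raddf0.
rewrite -fc; congr f; apply/funext => i; apply: nth_map.
by rewrite sn.
Qed.

Lemma seq_cochain_codom n (f : ('I_n -> Gamma) -> E) x : seq_cochain f (codom x) = f x.
Proof. by rewrite /seq_cochain size_codom card_ord eqxx nth_codom. Qed.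

Lemma cohomology_vanishesP rho n : (1 <= n)%N ->
  cohomology_vanishes rho n <-> vanishes (fun g h => g * h)%g (fun=> True) rho n.
Proof.
case: n => // n _; split=> [van f fe f0|van].
  have : cocycles rho (fun x : 'I_n.+2 -> Gamma => f (codom x)).
    split=> [g x|x]; first by rewrite (codom_map (fun h => g * h)%g) fe.
    by rewrite -[LHS](codiff_codom _ f) f0 // size_codom card_ord.
  rewrite van => -[h hc hE]; exists (seq_cochain h); first exact: seq_cochain_equivariant.
  move=> s _ sn; rewrite -(codom_nth 1%g s sn) codiff_codom.
  have <- := congr1 (fun f => f (fun i : 'I_n.+2 => nth 1%g s i)) hE.
  by apply: eq_bigr => i _; rewrite seq_cochain_codom.
apply/seteqP; split=> [f [fc f0]|_ [h hc <-]].
  have [s _ sn|h he hE] := van _ (seq_cochain_equivariant rho n.+1 f fc).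
    rewrite -(codom_nth 1%g s sn) codiff_codom -[RHS](f0 (fun i => nth 1%g s i)).
    by apply: eq_bigr => i _; rewrite seq_cochain_codom.
  exists (fun x => h (codom x)).
    by move=> g x /=; rewrite (codom_map (fun h => g * h)%g) he.
  apply/funext => x; rewrite -[RHS]seq_cochain_codom hE ?size_codom ?card_ord //.
  by rewrite codiff_codom.
have dh x : coboundary_map h x = codiff (seq_cochain h) (codom x).
  by rewrite codiff_codom; apply: eq_bigr => i _; rewrite seq_cochain_codom.
split=> [g x|x].
  rewrite !dh (codom_map (fun h => g * h)%g).
  exact: (equivariant_codiff _ _ _ (seq_cochain_equivariant _ _ _ hc)).
rewrite -[RHS](codiff_codiff (seq_cochain h) (codom x)) codiff_codom.
by apply: eq_bigr => i _; rewrite dh.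
Qed.

(** * Equivariant retraction of all tuples onto an acyclic family *)

Section Retraction.
Context {V : Type} (a : Gamma -> V -> V) (u : V -> Gamma) (P : seq V -> Prop).
Hypothesis a1 : forall v, a 1%g v = v.
Hypothesis aM : forall g h v, a (g * h)%g v = a g (a h v).
Hypothesis ua : forall g v, u (a g v) = (g * u v)%g.
Hypothesis P0 : P [::].
Hypothesis Pface : forall s t, P s -> is_face t s -> P t.
Hypothesis Pa : forall g s, P s -> P (map (a g) s).
Hypothesis Pacyclic : forall k (z : @chain E V),
  span (fun s => P s /\ size s = k) z -> (forall f, z (codiff f) = 0) ->
  exists w, span (fun s => P s /\ size s = k.+1) w /\ forall f, w (codiff f) = z f.

Let map_aM g h s : map (a g) (map (a h) s) = map (a (g * h)%g) s.
Proof. by rewrite -map_comp; apply: eq_map => v /=; rewrite aM. Qed.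

Let map_a1 s : map (a 1%g) s = s.
Proof. by rewrite -[RHS]map_id; apply: eq_map => v; rewrite a1. Qed.

Let PaE g s : P (map (a g) s) <-> P s.
Proof.
by split=> [/(Pa g^-1%g)|/(Pa g)//]; rewrite map_aM mulVg map_a1.
Qed.

Definition translate (g : Gamma) (z : @chain E V) : chain V :=
  fun f => z (fun s => f (map (a g) s)).

Definition filling (k : nat) (z : @chain E V) : chain V :=
  xget (fun=> 0) [set w | span (fun s => P s /\ size s = k) w /\
    forall f, w (codiff f) = z f].

(* The translation by [u x] moves the choice of a filling to a representative of
   each orbit, which makes it equivariant. *)
Definition retraction_step (s : seq V) (z : @chain E V) : chain V :=
  if pselect (P s) then fun f => f s else
  if s is x :: _ then translate (u x) (filling (size s) (translate (u x)^-1%g z))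
  else fun=> 0.

Definition retraction : seq V -> chain V := extend (fun f => f [::]) retraction_step.

Lemma retraction_id s : P s -> retraction s = fun f => f s.
Proof.
case: s => [//|x s] Ps; rewrite /retraction extendE // /retraction_step.
by case: pselect.
Qed.

(** All of [P] is the carrier. Translating the cycle before filling and the filling afterwards are
    inverse operations, so the boundary comes out right. *)
Lemma retraction_chain_map s :
  span (fun t => P t /\ size t = size s) (retraction s) /\
  forall f, retraction s (codiff f) = codiff (fun t => retraction t f) s.
Proof.
apply: (extend_chain_map _ (fun=> True) (fun s t => P t /\ size t = size s)) => //.
move=> {s} s sT s0 Pz z0; have [Ps|nPs] := pselect (P s).
  rewrite retraction_id //; split; first exact: (span_gen _ s).
  by move=> f; apply: eq_codiff => t ts; rewrite retraction_id //; exact: Pface ts.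
case: s s0 nPs Pz z0 => // x s s0 nPs Pz z0.
rewrite {1 2}/retraction extendE // -/retraction /retraction_step.
case: pselect => // nPs'; set z : chain V := fun f => codiff _ _.
have ex : exists w, [set w | span (fun t => P t /\ size t = size (x :: s)) w /\
    forall f, w (codiff f) = translate (u x)^-1%g z f] w.
  apply: (Pacyclic (size s)).
    apply: (span_map _ _ (map (a (u x)^-1%g)) _ _ Pz) => t [r rs [Pt st]].
    by rewrite size_map st; have [->] := is_face_size _ _ rs; split=> //; exact: Pa.
  move=> f; rewrite /translate -[RHS](z0 (fun t => f (map (a (u x)^-1%g) t))).
  by rewrite /z; apply: eq_codiff => t _; congr (retraction t _);
    apply/funext => r; rewrite codiff_map.
have [Pw wE] := xgetPex (fun=> 0) ex; rewrite -/(filling _ _) in Pw wE.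
split.
  apply: (span_map _ _ (map (a (u x))) _ _ Pw) => t [Pt st].
  by rewrite size_map st; split=> //; exact: Pa.
move=> f.
rewrite -[LHS]/(filling (size (x :: s)) (translate (u x)^-1%g z)
  (fun t => codiff f (map (a (u x)) t))).
have -> : (fun t => codiff f (map (a (u x)) t)) = codiff (fun t => f (map (a (u x)) t)).
  by apply/funext => t; rewrite codiff_map.
rewrite wE /translate; congr z; apply/funext => t.
by rewrite map_aM mulgV map_a1.
Qed.

(** Moving the first vertex by [g] multiplies its [u] by [g]; after normalization both lists present
    the same cycle and so receive the same chosen filling. *)
Lemma retraction_equivariant g s f :
  retraction (map (a g) s) f = retraction s (fun t => f (map (a g) t)).
Proof.
apply: extend_equivariant => // -[//|x {}s] z _.
rewrite /retraction_step.
case: pselect => [Ps|nP]; case: pselect => [Ps'|nP'] //.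
- by case: nP'; exact: (PaE g (x :: s)).1 Ps.
- by case: nP; exact: (PaE g (x :: s)).2 Ps'.
apply/funext => {}f; rewrite /= size_map ua /translate; congr (filling _ _ _).
  by apply/funext => f'; congr z; apply/funext => t; rewrite map_aM invgM -mulgA mulVg mulg1.
by apply/funext => t; rewrite map_aM.
Qed.

Lemma retraction_pullback rho f : equivariant a rho f ->
  equivariant a rho (fun s => retraction s f).
Proof.
apply: (equivariant_pullback a a) => [g s f'|s]; first exact: retraction_equivariant.
by apply: span_mono (retraction_chain_map s).1.
Qed.

(** Pulling back along the retraction turns a cocycle on [P] into one on all lists and changes
    nothing on [P]. *)
Lemma vanishes_restrict rho n :
  vanishes a (fun=> True) rho n -> vanishes a P rho n.
Proof.
move=> van f fe f0.
have [s _ sn|h he hE] := van _ (retraction_pullback rho f fe).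
  rewrite -(retraction_chain_map s).2; apply: (span0f _ _ _ (retraction_chain_map s).1).
  by move=> t [Pt tn]; apply: f0 => //; rewrite tn.
by exists h => // s Ps sn; rewrite -hE // retraction_id.
Qed.

(** Subtracting the coboundary of the extended primitive [h'] leaves a cocycle [f'] that is zero on
    [P], hence killed by the retraction. The homotopy [r] between identity and retraction then shows
    [f'] to be minus the coboundary of [r f']. *)
Lemma vanishes_extend rho n :
  vanishes a P rho n -> vanishes a (fun=> True) rho n.
Proof.
move=> van f fe f0.
have [s _ sn|h he hE] := van f fe; first exact: f0.
pose h' s := retraction s h.
have he' : equivariant a rho h' := retraction_pullback rho h he.
pose f' s := f s - codiff h' s.
have f'P s : P s -> size s = n.+1 -> f' s = 0.
  move=> Ps sn; rewrite /f' (hE s Ps sn); apply/eqP; rewrite subr_eq0; apply/eqP.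
  by apply: eq_codiff => t ts; rewrite /h' retraction_id //; exact: Pface ts.
pose r := cone_homotopy retraction.
have rs s : span (fun t => size t = (size s).+1) (r s).
  apply: (span_cone_homotopy _ (fun=> True) (fun s t => size t = (size s).+1)) => //.
  - move=> x t _; apply: span_mono (retraction_chain_map _).1 => p [_ /= ->].
    by [].
  - by move=> x t w p _ /is_face_size[st] pw; rewrite /= pw st.
exists (fun s => h' s - r s f').
  apply: equivariantB => //; apply: (equivariant_pullback a a).
  - by move=> g s f1; apply: cone_homotopy_equivariant => *; exact: retraction_equivariant.
  - by move=> s; apply: span_mono (rs s).
  - by apply: equivariantB => //; exact: equivariant_codiff.
move=> s _ sn; rewrite codiffB.
have : r s (codiff f') = retraction s f' - f' s - codiff (fun t => r t f') s.
  apply: (cone_homotopy_codiff _ (fun=> True) (fun s t => P t /\ size t = size s)) => //.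
  - by move=> t _; exact: (retraction_chain_map t).1.
  - by move=> t f1 _; exact: (retraction_chain_map t).2.
rewrite (span0f _ _ _ (rs s)); last first.
  by move=> t st; rewrite codiffB codiff_codiff f0 ?subr0 // st sn.
rewrite (span0f _ _ _ (retraction_chain_map s).1); last first.
  by move=> t [Pt st]; apply: f'P => //; rewrite st sn.
move/esym/eqP; rewrite sub0r subr_eq add0r => /eqP <-.
by rewrite opprK /f' addrC subrK.
Qed.

End Retraction.
End GroupCohomology.

(** * Orbits of simplices *)

Section UniformPoint.
Context {R : realType}.

Lemma sum_count_mem {V : choiceType} (F s : seq V) (p : pred V) : uniq F ->
  {subset s <= F} ->
  \sum_(v <- F | p v) (count_mem v s)%:R = (count p s)%:R :> R.
Proof.
move=> uF; elim: s => [|w s IH] sF.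
  by rewrite big1 // => v _.
rewrite /= natrD -IH; last by move=> v vs; apply: sF; rewrite inE vs orbT.
under eq_bigr do rewrite natrD; rewrite big_split /=; congr (_ + _).
have wF := sF w (mem_head _ _).
rewrite big_mkcond (bigD1_seq w) //= eqxx big1 ?addr0; last first.
  by move=> v /negPf vw; rewrite eq_sym vw; case: ifP.
by case: ifP.
Qed.

(** The barycentre counted with multiplicity: a simplicial map sends it to the barycentre of the
    image list even if vertices are identified, and its support gives back the vertices. *)
Definition uniform_weight {X : simplicial_complex} (s : seq (vertex X))
    (v : vertex X) : R := (count_mem v s)%:R / (size s)%:R.

Lemma uniform_weight_neq0 {X : simplicial_complex} (s : seq (vertex X)) v :
  (uniform_weight s v != 0) = (v \in s).
Proof.
rewrite /uniform_weight mulf_eq0 invr_eq0 !pnatr_eq0 negb_or -!lt0n -has_count has_pred1.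
by case: s => //= w s; rewrite andbT.
Qed.

Lemma uniform_barycentric {X : simplicial_complex} (s : seq (vertex X)) :
  s <> [::] -> spans_simplex s -> barycentric (uniform_weight s) [fset v in s]%fset.
Proof.
move=> s0 ss; split.
- exact: ss.
- by move=> v; rewrite divr_ge0.
- by move=> v; rewrite inE uniform_weight_neq0.
- rewrite -mulr_suml sum_count_mem ?fset_uniq //; last by move=> v; rewrite inE.
  rewrite count_predT divff // pnatr_eq0; apply/eqP => /size0nil.
  exact: s0.
Qed.

Lemma realize_uniform_weight {X Y : simplicial_complex} (f : simplicial_map X Y)
    (q : realization R X) (s : seq (vertex X)) :
  s <> [::] -> spans_simplex s -> Defs.coord q = uniform_weight s ->
  Defs.coord (realize f q) = uniform_weight (map f s).
Proof.
move=> s0 ss qs; apply/funext => w.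
have qb : barycentric (Defs.coord q) [fset v in s]%fset.
  by rewrite qs; exact: uniform_barycentric.
rewrite /= (realize_coordE _ _ qb) qs -mulr_suml.
rewrite (sum_count_mem _ s (fun v => f v == w)) ?fset_uniq //; last by move=> v; rewrite inE.
by rewrite /uniform_weight size_map count_map.
Qed.

End UniformPoint.

Fixpoint words {T : eqType} (B : seq T) (k : nat) : seq (seq T) :=
  if k is k'.+1 then [seq x :: s | x <- B, s <- words B k'] else [:: [::]].

Lemma mem_words {T : eqType} (B s : seq T) : {subset s <= B} -> s \in words B (size s).
Proof.
elim: s => [|x s IH] sB /=; first by rewrite inE.
apply: (allpairs_f (fun x s => x :: s)); first exact: sB (mem_head _ _).
by apply: IH => y ys; apply: sB; rewrite inE ys orbT.
Qed.

(** * The deck group acting on ordered simplices *)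

Section DeckAction.
Context {R : realType} {Gamma : groupType} (X : eilenberg_maclane R Gamma).
Local Notation V := (vertex (em_cover X)).
Local Notation act := (em_act X).
Local Notation p := (em_proj X).

Lemma spans_simplex_map {Y Z : simplicial_complex} (f : simplicial_map Y Z) s :
  spans_simplex s -> spans_simplex (map f s).
Proof.
move=> ss s0; have {}ss := ss (fun e => s0 (congr1 (map f) e)).
have := smapP f ss; congr simplex; apply/fsetP => w; rewrite inE.
apply/imfsetP/mapP => -[v /=]; rewrite ?inE => vs ->; exists v => //=.
by rewrite inE.
Qed.

Lemma uniform_point_exists {Y : simplicial_complex} (s : seq (vertex Y)) :
  s <> [::] -> spans_simplex s ->
  exists q : realization R Y, Defs.coord q = uniform_weight s.
Proof.
move=> s0 ss; have b := uniform_barycentric (R := R) s s0 ss.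
by exists (Realization (ex_intro _ _ b)).
Qed.

(** The barycentres of [s] and [t] lie over the same point, so a deck transformation carries one to
    the other and matches their supports. The order of the vertices is lost. *)
Lemma same_projection_deck (s t : seq V) : s <> [::] -> spans_simplex s ->
  spans_simplex t -> map p s = map p t -> exists g, t =i map (act g) s.
Proof.
move=> s0 ss ts st.
have t0 : t <> [::].
  by move=> t0; apply: s0; apply: size0nil; rewrite -(size_map p) st t0.
have [q qE] := uniform_point_exists s s0 ss.
have [r rE] := uniform_point_exists t t0 ts.
have qr : realize p q = realize p r.
  apply: realization_eq.
  by rewrite (realize_uniform_weight _ _ s) // (realize_uniform_weight _ _ t) // st.
have [g [gqr _]] := em_simply_transitive qr; exists g => v.
rewrite -(uniform_weight_neq0 (R := R)) -rE -gqr (realize_uniform_weight _ _ s) //.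
by rewrite uniform_weight_neq0.
Qed.

(** Both [g] and the identity fix the point of the realization at [v], and the deck transformation
    doing so is unique. *)
Lemma deck_free g (v : V) : act g v = v -> g = 1%g.
Proof.
move=> gv; have sv : spans_simplex [:: v].
  move=> _; have := simplex1 v; congr simplex.
  by apply/fsetP => w; rewrite !inE /= ?mem_seq1 ?orbF.
have [q qE] := uniform_point_exists [:: v] ltac:(by []) sv.
have [h [_ hU]] := em_simply_transitive (erefl (realize p q)).
have fixq k : act k v = v -> realize (act k) q = q.
  move=> kv; apply: realization_eq; rewrite (realize_uniform_weight _ _ [:: v]) //.
  by rewrite qE /= kv.
by rewrite -(hU g) ?(hU 1%g) //; apply: fixq => //; exact: em_act1.
Qed.

(** A base vertex [r v] is chosen in each orbit, and [u v] is the element carrying it to [v], unique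
    by freeness. *)
Lemma orbit_coordinate : exists u : V -> Gamma, forall g v, u (act g v) = (g * u v)%g.
Proof.
have [[v0]|nV] := pselect (inhabited V); last first.
  by exists (fun=> 1%g) => g v; case: nV; exists; exact: v.
pose r v : V := xget v0 [set w | exists g, act g w = v].
have rP v : exists g, act g (r v) = v.
  apply: (xgetPex v0 (P := [set w | exists g, act g w = v])).
  by exists v, 1%g; exact: em_act1.
have r_act g v : r (act g v) = r v.
  congr xget; apply/seteqP; split=> w [h hw] /=.
    by exists (g^-1 * h)%g; rewrite em_actM hw -em_actM mulVg em_act1.
  by exists (g * h)%g; rewrite em_actM hw.
pose u v : Gamma := sval (cid (rP v)).
have uP v : act (u v) (r v) = v := svalP (cid (rP v)).
exists u => g v; apply: (mulgI (g * u v)^-1%g); rewrite mulVg.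
apply: (deck_free _ (r v)).
have uu : act (u (act g v)) (r v) = act (g * u v)%g (r v).
  by rewrite em_actM (uP v) -(r_act g v) uP.
by rewrite em_actM uu -em_actM mulVg em_act1.
Qed.

Lemma finite_vertices n : finite_skeleton (em_base X) n ->
  exists B : seq (vertex (em_base X)), forall v, v \in B.
Proof.
move=> fin.
have : finite_set [set: vertex (em_base X)].
  apply: (@sub_finite_set _ _ ((fun v => [fset v]%fset) @^-1`
      [set s | simplex s /\ (#|` s| <= n.+1)%N])).
    by move=> v _ /=; split; [exact: simplex1|rewrite cardfs1].
  apply: finite_preimage fin => v w _ _ /fset1_inj; exact.
move/finite_seqP => [B BE]; exists B => v.
by have : [set: vertex (em_base X)] v by []; rewrite BE.
Qed.

(** The base has finitely many words of length [k] in its vertices; one lift of each liftable word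
    is fixed. Any other lift is a translate of a word in the vertices of the fixed one, and
    [u v = 1] singles out the translate. *)
Lemma finite_normalized_simplices (u : V -> Gamma) (n k : nat) :
  finite_skeleton (em_base X) n ->
  (forall g v, u (act g v) = (g * u v)%g) ->
  exists N : seq (seq V), forall v s, spans_simplex (v :: s) -> size (v :: s) = k ->
    u v = 1%g -> v :: s \in N.
Proof.
move=> /finite_vertices[B BP] ua.
have [[v0]|nV] := pselect (inhabited V); last first.
  by exists [::] => v; case: nV; exists.
pose r (c : seq (vertex (em_base X))) : seq V :=
  xget [::] [set s | [/\ s <> [::], spans_simplex s, size s = k & map p s = c]].
exists (flatten [seq [seq map (act (u (head v0 s))^-1%g) s | s <- words (r c) k]
                | c <- words B k]).
move=> v s; set vs := v :: s => ss sk uv.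
have ex : exists t, [set t | [/\ t <> [::], spans_simplex t, size t = k &
    map p t = map p vs]] t by exists vs.
have [r0 rs rk rp] := xgetPex [::] ex; rewrite -/(r (map p vs)) in r0 rs rk rp.
have [g gE] := same_projection_deck _ _ r0 rs ss rp.
apply/flattenP; exists [seq map (act (u (head v0 t))^-1%g) t | t <- words (r (map p vs)) k].
  by apply: map_f; rewrite -sk -(size_map p); apply: mem_words.
(* The head of this word has [u] equal to [g^-1], so normalizing it returns [vs]. *)
apply/mapP; exists (map (act g^-1%g) vs).
  rewrite -sk -(size_map (act g^-1%g)); apply: mem_words => w /mapP[x].
  by rewrite gE => /mapP[y yr ->] ->; rewrite -em_actM mulVg em_act1.
rewrite /= ua uv mulg1 invgK -em_actM mulgV em_act1 -map_comp.
by congr cons; rewrite -[LHS]map_id; apply: eq_map => x /=; rewrite -em_actM mulgV em_act1.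
Qed.

End DeckAction.

(** * Limits of matrices and their ranks *)

Section MatrixLimits.
Context {R : realType} {T : Type} {F : set_system T} {FF : Filter F}.

Definition mx_cvg {m n} (A : T -> 'M[R]_(m, n)) (A0 : 'M[R]_(m, n)) : Prop :=
  forall i j, A t i j @[t --> F] --> A0 i j.

Lemma mx_cvg_cst {m n} (A : 'M[R]_(m, n)) : mx_cvg (fun=> A) A.
Proof. by move=> i j; exact: cvg_cst. Qed.

Lemma mx_cvg_mul {m n p} (A : T -> 'M[R]_(m, n)) A0 (B : T -> 'M[R]_(n, p)) B0 :
  mx_cvg A A0 -> mx_cvg B B0 -> mx_cvg (fun t => A t *m B t) (A0 *m B0).
Proof.
move=> AA BB i j; rewrite mxE; under eq_cvg do rewrite mxE.
apply: cvg_big => [|k _]; first exact: add_continuous.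
exact: cvgM.
Qed.

Lemma mx_cvgB {m n} (A B : T -> 'M[R]_(m, n)) A0 B0 :
  mx_cvg A A0 -> mx_cvg B B0 -> mx_cvg (fun t => A t - B t) (A0 - B0).
Proof.
move=> AA BB i j; rewrite !mxE; under eq_cvg do rewrite !mxE.
exact: cvgB.
Qed.

Lemma det_cvg {n} (A : T -> 'M[R]_n) A0 : mx_cvg A A0 ->
  \det (A t) @[t --> F] --> \det A0.
Proof.
move=> AA; apply: cvg_big => [|s _]; first exact: add_continuous.
apply: cvgM; first exact: cvg_cst.
apply: cvg_big => [|k _]; first exact: mul_continuous.
exact: AA.
Qed.

(** By the cofactor formula the entries of the inverse are quotients of polynomials in the entries,
    with a denominator whose limit is nonzero. *)
Lemma mx_cvg_inv {n} (A B : T -> 'M[R]_n) A0 :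
  mx_cvg A A0 -> (forall t, B t *m A t = 1%:M) -> A0 \in unitmx ->
  mx_cvg B (invmx A0).
Proof.
move=> AA BA A0u i j.
have Au t : A t \in unitmx by have /mulmx1_unit[] := BA t.
have -> : B = fun t => invmx (A t).
  by apply/funext => t; rewrite -[LHS]mulmx1 -(mulmxV (Au t)) mulmxA BA mul1mx.
rewrite /invmx A0u !mxE; under eq_cvg => t do rewrite Au !mxE.
have d0 : \det A0 != 0 by rewrite -unitfE -unitmxE.
apply: cvgM; first by apply: cvgV => //; exact: det_cvg.
rewrite /cofactor; apply: cvgM; first exact: cvg_cst.
by apply: det_cvg => k l; rewrite !mxE; under eq_cvg do rewrite !mxE; exact: AA.
Qed.

(** Multiplication by [P] and [Q] compresses [A0] to an identity matrix of size [\rank A0]. The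
    determinant of the compressed [A t] tends to 1, so it is eventually nonzero. *)
Lemma rank_lower_semicontinuous {m n} (A : T -> 'M[R]_(m, n)) A0 :
  mx_cvg A A0 -> \forall t \near F, (\rank A0 <= \rank (A t))%N.
Proof.
move=> AA; pose P := pinvmx (col_base A0); pose Q := pinvmx (row_base A0).
have PAQ : P *m A0 *m Q = 1%:M.
  have -> : P *m A0 = P *m (col_base A0 *m row_base A0) by rewrite mulmx_base.
  rewrite mulmxA mulVpmx ?col_base_full // mul1mx.
  by rewrite mulmxVp ?row_base_free.
have : \det (P *m A t *m Q) @[t --> F] --> (1 : R).
  rewrite -(det1 R (\rank A0)) -PAQ; apply: det_cvg.
  by do 2 apply: mx_cvg_mul => //; exact: mx_cvg_cst.
move/cvgr_neq0 => /(_ (oner_neq0 _)); apply: filterS => t dt.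
have -> : \rank A0 = \rank (P *m A t *m Q).
  by apply/esym/mxrank_unit; rewrite unitmxE unitfE.
by apply: leq_trans (mxrankM_maxl _ _) _; exact: mxrankM_maxr.
Qed.

(** Eventually [\rank (A t) >= \rank A0 >= n - \rank B0 >= n - \rank (B t)], while the row space of
    [A t] lies in the kernel of [B t]; so the two coincide. *)
Lemma exact_open {m n p} (A : T -> 'M[R]_(m, n)) A0 (B : T -> 'M[R]_(n, p)) B0 :
  (forall t, A t *m B t = 0) -> mx_cvg A A0 -> mx_cvg B B0 ->
  (kermx B0 <= A0)%MS -> \forall t \near F, (kermx (B t) <= A t)%MS.
Proof.
move=> AB0 AA BB ex.
apply: filterS2 (rank_lower_semicontinuous _ _ AA) (rank_lower_semicontinuous _ _ BB).
move=> t rA rB.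
have le : (A t <= kermx (B t))%MS by apply/sub_kermxP.
rewrite -(mxrank_leqif_sup le).
rewrite eqn_leq mxrankS //= (leq_trans _ rA) // (leq_trans _ (mxrankS ex)) //.
by rewrite !mxrank_ker leq_sub2l.
Qed.

End MatrixLimits.

Section LinearMatrix.
Context {R : comNzRingType}.

Definition matrix_of {m n} (f : 'rV[R]_m -> 'rV[R]_n) : 'M[R]_(m, n) :=
  \matrix_i f (delta_mx 0 i).

Lemma mul_matrix_of {m n} (f : 'rV[R]_m -> 'rV[R]_n) x :
  {morph f : x y / x - y} -> (forall a, {morph f : x / a *: x}) ->
  x *m matrix_of f = f x.
Proof.
move=> fB fZ.
have f0 : f 0 = 0 by rewrite -(subrr 0) fB subrr.
have fD : {morph f : x y / x + y}.
  by move=> y z; rewrite -[z in LHS]opprK fB -[- z]sub0r fB f0 sub0r opprK.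
rewrite mulmx_sum_row [in RHS](row_sum_delta x) (big_morph f fD f0).
by apply: eq_bigr => i _; rewrite rowK fZ.
Qed.

End LinearMatrix.

(** * Real coordinates *)

Section RealCoordinates.
Context {R : realType} {K : numFieldType} {emb : R -> K}.
Hypothesis HK : scalar_field emb.

Lemma emb0 : emb 0 = 0. Proof. by case: HK => //; exact: rmorph0. Qed.
Lemma emb1 : emb 1 = 1. Proof. by case: HK => //; exact: rmorph1. Qed.
Lemma embD : {morph emb : x y / x + y}.
Proof. by case: HK => // x y; exact: rmorphD. Qed.
Lemma embM : {morph emb : x y / x * y}.
Proof. by case: HK => // x y; exact: rmorphM. Qed.
Lemma embN : {morph emb : x / - x}.
Proof. by case: HK => // x; exact: rmorphN. Qed.
Lemma ler_emb x y : (emb x <= emb y) = (x <= y).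
Proof. by case: HK => //; exact: lecR. Qed.
Lemma norm_emb x : `|emb x| = emb `|x|.
Proof.
have [x0|x0] := lerP 0 x; first by rewrite (ger0_norm x0) ger0_norm // -emb0 ler_emb.
by rewrite (ltr0_norm x0) embN ler0_norm // -emb0 ler_emb ltW.
Qed.
Lemma emb_ge0P k : 0 <= k -> exists2 r, 0 <= r & emb r = k.
Proof.
case: HK k => [k k0|[r i]]; first by exists k.
by rewrite lecE /= => /andP[/eqP -> r0]; exists r.
Qed.
Lemma emb_basis : exists w, forall k, exists a b, k = emb a + emb b * w.
Proof.
case: HK; first by exists 0 => k; exists k, 0; rewrite mulr0 addr0.
exists 'i%C => -[a b]; exists a, b; by rewrite [LHS]complexE mulrC.
Qed.
Lemma embB : {morph emb : x y / x - y}.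
Proof. by move=> x y; rewrite embD embN. Qed.
Context {E : normedModType K}.

Definition real_combination {q} (c : 'I_q -> E) (x : 'rV[R]_q) : E :=
  \sum_i emb (x 0 i) *: c i.

Lemma real_combinationB {q} (c : 'I_q -> E) : {morph real_combination c : x y / x - y}.
Proof.
move=> x y; rewrite /real_combination -sumrB; apply: eq_bigr => i _.
by rewrite !mxE embB scalerBl.
Qed.

Lemma real_combinationZ {q} (c : 'I_q -> E) a x :
  real_combination c (a *: x) = emb a *: real_combination c x.
Proof.
rewrite /real_combination scaler_sumr; apply: eq_bigr => i _.
by rewrite !mxE embM scalerA.
Qed.

Lemma real_basis : finite_dimensional E ->
  exists q (c : 'I_q -> E), bijective (real_combination c).
Proof.
move=> [m [b bspan]].
pose spanning q := exists c : 'I_q -> E, forall x, exists y, x = real_combination c y.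
have exq : exists q, `[< spanning q >].
  have [w wP] := emb_basis.
  exists (m + m)%N; apply/asboolP.
  (* The generators and their multiples by [w] span over the reals. Redundancies, as when [w] is
     [0], disappear with the minimal [q]. *)
  exists (fun i => match fintype.split i with inl j => b j | inr j => w *: b j end) => x.
  have [k ->] := bspan x.
  have /choice[ab abP] : forall i, exists ab : R * R, k i = emb ab.1 + emb ab.2 * w.
    by move=> i; have [r [s ->]] := wP (k i); exists (r, s).
  exists (\row_i match fintype.split i with inl j => (ab j).1 | inr j => (ab j).2 end).
  rewrite /real_combination big_split_ord /= -big_split /=; apply: eq_bigr => i _.
  have sl : fintype.split (lshift m i) = inl i by exact: (unsplitK (inl i)).
  have sr : fintype.split (rshift m i) = inr i by exact: (unsplitK (inr i)).
  by rewrite !mxE sl sr abP scalerDl scalerA.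
case: (ex_minnP exq) => q /asboolP[c cspan] qmin; exists q, c.
(* A nontrivial relation [y] would eliminate a generator [c j] with [y 0 j != 0], against the
   minimality of [q]. *)
have cfree y : real_combination c y = 0 -> y = 0.
  move=> y0; apply/eqP/negPn/negP => /eqP ynz.
  have [j yj] : exists j, y 0 j != 0.
    apply: contrapT => /forallNP h; apply: ynz; apply/rowP => j; rewrite mxE.
    by apply/eqP/negPn/negP/h.
  case: q => [|q] in c cspan qmin y y0 ynz j yj *; first by case: j {yj}.
  suff : (q.+1 <= q)%N by rewrite ltnn.
  apply: qmin; apply/asboolP; exists (fun i => c (lift j i)) => x.
  have [d ->] := cspan x.
  exists (\row_i (d - (d 0 j / y 0 j) *: y) 0 (lift j i)).
  rewrite -[LHS]subr0 -(scaler0 _ (emb (d 0 j / y 0 j))) -y0.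
  rewrite -real_combinationZ -real_combinationB /real_combination (bigD1_ord j) //=.
  rewrite !mxE divfK // subrr emb0 scale0r add0r; apply: eq_bigr => i _.
  by rewrite !mxE.
have cinj : injective (real_combination c).
  move=> x y xy; apply/eqP; rewrite -subr_eq0; apply/eqP/cfree.
  by rewrite real_combinationB xy subrr.
have [g gP] := choice cspan.
by exists g => [x|x]; [apply: cinj; rewrite -gP|rewrite -gP].
Qed.

(** * Comparison of the norm with real coordinates *)

Section CoordinateBound.
Context {q : nat} (c : 'I_q -> E).
Hypothesis cinj : injective (real_combination c).
Local Notation e := (real_combination c).

Lemma real_norm_exists : exists2 N : E -> R, forall x, 0 <= N x &
  forall x, emb (N x) = `|x|.
Proof.
have /choice[N NP] : forall x : E, exists r : R, 0 <= r /\ emb r = `|x|.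
  by move=> x; have [r r0 rx] := emb_ge0P _ (normr_ge0 x); exists r.
by exists N => x; case: (NP x).
Qed.

(** Equivalence of norms in finite dimension: [N \o e] is positive, hence bounded away from zero, on
    the compact unit sphere of coordinates; homogeneity gives the rest. *)
Lemma coordinate_bound : exists2 C : R, 0 < C &
  forall (x : 'rV[R]_q) i, emb (C * `|x 0 i|) <= `|e x|.
Proof.
have [N N0 NE] := real_norm_exists.
have NZ a x : N (emb a *: x) = `|a| * N x.
  by apply/eqP; rewrite eq_le -!ler_emb embM !NE normrZ norm_emb lexx.
have Ntri x y : N (x + y) <= N x + N y.
  by rewrite -ler_emb embD !NE ler_normD.
have N00 : N 0 = 0.
  by apply/eqP; rewrite eq_le N0 andbT -ler_emb NE normr0 emb0.
have Ngt0 x : x != 0 -> 0 < N (e x).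
  move=> x0; rewrite lt_neqAle N0 andbT eq_sym; apply: contra x0 => /eqP Nx.
  have := NE (e x); rewrite Nx emb0 => /esym/normr0_eq0 ex.
  apply/eqP; apply: cinj; rewrite ex /real_combination big1 // => i _.
  by rewrite mxE emb0 scale0r.
have coord_le (x : 'rV[R]_q) i : `|x 0 i| <= `|x|.
  rewrite [leRHS]/Num.Def.normr /= mx_normrE.
  by apply: (le_bigmax _ (fun ij => `|x ij.1 ij.2|) (0, i)).
(* A Lipschitz constant of [N \o e]; the summand [1] makes it positive. *)
pose C := 1 + \sum_i N (c i).
have C1 : 1 <= C by rewrite lerDl sumr_ge0.
have C0 : 0 < C by exact: lt_le_trans C1.
have NC x : N (e x) <= C * `|x|.
  apply: (@le_trans _ _ (\sum_i N (c i) * `|x|)).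
    rewrite /real_combination; elim/big_ind2: _ => [|x1 y1 x2 y2 h1 h2|i _].
    - by rewrite N00.
    - by apply: le_trans (Ntri _ _) _; exact: lerD.
    - by rewrite NZ mulrC ler_wpM2l.
  by rewrite -mulr_suml ler_wpM2r // lerDr.
pose A := [set x : 'rV[R]_q | `|x| = 1].
have cA : compact A.
  apply: bounded_closed_compact.
    by exists 1; split=> // M M1 x /= ->; exact: ltW.
  apply: (@preimage_closed _ _ (fun x : 'rV[R]_q => `|x|) [set r : R | r = 1]);
    last exact: closed_eq.
  by move=> x _; exact: norm_continuous.
have near_d x : A x -> \forall x' \near x & d \near (0 : R)^'+, d < N (e x').
  move=> Ax; have x0 : x != 0.
    by rewrite -normr_eq0 Ax oner_neq0.
  have Nx := Ngt0 x x0.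
  have r0 : 0 < N (e x) / 2 / C by rewrite !divr_gt0.
  exists ([set y | `|x - y| < N (e x) / 2 / C], [set d | d < N (e x) / 2]).
    split; last by apply: nbhs_right_lt; rewrite divr_gt0.
    by have := nbhsx_ballx x _ r0; rewrite -ball_normE.
  move=> [y d] /= [xy de].
  have h : N (e x) <= N (e y) + C * `|x - y|.
    rewrite (le_trans _ (lerD (lexx _) (NC _))) // real_combinationB.
    by rewrite -{1}[e x](subrK (e y)) addrC; exact: Ntri.
  have : C * `|x - y| < N (e x) / 2 by rewrite mulrC -ltr_pdivlMr.
  lra.
have [d [d0 dA]] := filter_ex (filterI (nbhs_right_gt (0 : R))
  ((compact_near_coveringP _).1 cA _ _ (fun d x => d < N (e x)) _ near_d)).
exists d => // x i; rewrite -NE ler_emb.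
have [->|x0] := eqVneq x 0; first by rewrite mxE normr0 mulr0.
have nx : 0 < `|x| by rewrite normr_gt0.
have : d < N (e (`|x|^-1 *: x)).
  by apply: dA; rewrite /A /= normrZ normfV normr_id mulVf ?gt_eqF.
rewrite real_combinationZ NZ normfV normr_id mulrC ltr_pdivlMr // => /ltW.
by apply: le_trans; rewrite ler_wpM2l // ltW.
Qed.
End CoordinateBound.
End RealCoordinates.

(** * Deformations of representations *)

Section Deformations.
Context {R : realType} {K : numFieldType} {emb : R -> K}.
Hypothesis HK : scalar_field emb.
Context {Gamma : groupType} {E : normedModType K}.
Implicit Types rho : representation Gamma E.

Lemma rep_real_bound rho g :
  exists2 r, 0 <= r & forall x, `|rho g x| <= emb r * `|x|.
Proof.
have [c cP] := rep_bounded rho g.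
(* On the zero space the given bound [c] may fail to be a nonnegative real, so that case is settled
   apart. *)
have [[x x0]|E0] := pselect (exists x : E, x != 0); last first.
  exists 0 => // x; have [->|xn] := eqVneq x 0; first by rewrite raddf0 !normr0 mulr0.
  by case: E0; exists x.
have nx : 0 < `|x| by rewrite normr_gt0.
have : 0 <= c by rewrite -(pmulr_lge0 _ nx) (le_trans (normr_ge0 _) (cP x)).
by move=> /(emb_ge0P HK)[r r0 rc]; exists r => // y; rewrite rc.
Qed.

(** Finiteness of [S] bounds the set of norms, so its supremum dominates each of them. The infimum
    [opnorm] is at most [eps < 2 * eps], so an admissible constant exists below [2 * eps]; hence the
    factor. *)
Lemma deformation_bound (S : set Gamma) (eps : R) (pi rho : representation Gamma E) :
  finite_set S -> 0 < eps -> deformation emb S eps pi rho ->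
  forall s, S s -> forall x, `|pi s x - rho s x| <= emb (2 * eps) * `|x|.
Proof.
move=> Sfin eps0 dpr s Ss x.
have ub : has_ubound [set opnorm emb (pi s \- rho s) | s in S].
  have /finite_seqP[l ->] := finite_image (fun s => opnorm emb (pi s \- rho s)) Sfin.
  exists (\sum_(y <- l) `|y|) => y /= yl.
  rewrite (le_trans (ler_norm y)) // (big_rem y yl) /= lerDl.
  exact: sumr_ge0.
have le_eps : opnorm emb (pi s \- rho s) <= eps.
  by apply: le_trans dpr; apply: (ub_le_sup ub); exists s.
have ne : [set c : R | 0 <= c /\ forall x, `|(pi s \- rho s) x| <= emb c * `|x|] !=set0.
  have [a a0 aP] := rep_real_bound pi s; have [b b0 bP] := rep_real_bound rho s.
  exists (a + b); split=> [|y]; first exact: addr_ge0.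
  by rewrite (embD HK) mulrDl (le_trans (ler_normB _ _)) // lerD.
have [|c [c0 cP] ceps] := inf_lt ne (x := 2 * eps).
  by apply: le_lt_trans le_eps _; rewrite ltr_pMl // ltr1n.
apply: le_trans (cP x) _; rewrite ler_wpM2r // ler_emb //.
exact: ltW.
Qed.

Definition near_rep (S : set Gamma) (pi : representation Gamma E) :
    set_system (representation Gamma E) :=
  [set A | exists2 eps : R, 0 < eps & forall rho, deformation emb S eps pi rho -> A rho].

#[global] Instance near_rep_filter (S : set Gamma) pi : Filter (near_rep S pi).
Proof.
split.
- by exists 1.
- move=> A B [d d0 dA] [e e0 eB]; exists (Num.min d e); first by rewrite lt_min d0.
  move=> rho dpr; split; [apply: dA|apply: eB]; apply: le_trans dpr _;
    by rewrite ge_min lexx ?orbT.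
- by move=> A B AB [d d0 dA]; exists d => // rho /dA; exact: AB.
Qed.

Context {q : nat} {c : 'I_q -> E} (coords : E -> 'rV[R]_q).
Local Notation e := (@real_combination R K emb E q c).
Hypothesis coordsK : cancel coords e.
Hypothesis eK : cancel e coords.

Lemma coordsB : {morph coords : x y / x - y}.
Proof.
move=> x y; apply: (can_inj eK).
by rewrite coordsK (real_combinationB HK) !coordsK.
Qed.

Lemma coordsZ a x : coords (emb a *: x) = a *: coords x.
Proof.
by apply: (can_inj eK); rewrite coordsK (real_combinationZ HK) coordsK.
Qed.

Definition rep_mx rho g : 'M[R]_q := matrix_of (fun x => coords (rho g (e x))).

Lemma mul_rep_mx rho g x : x *m rep_mx rho g = coords (rho g (e x)).
Proof.
rewrite mul_matrix_of // => [y z|a y].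
  by rewrite (real_combinationB HK) raddfB coordsB.
by rewrite (real_combinationZ HK) linearZ /= coordsZ.
Qed.

Lemma rep_mx1 rho : rep_mx rho 1%g = 1%:M.
Proof.
apply/row_matrixP => i; rewrite !rowE mul_rep_mx mulmx1.
by rewrite rep1 eK.
Qed.

(** Coordinates are row vectors, which reverses the order of the product. *)
Lemma rep_mxM rho g h : rep_mx rho (g * h)%g = rep_mx rho h *m rep_mx rho g.
Proof.
apply/row_matrixP => i; rewrite !rowE mulmxA !mul_rep_mx.
by rewrite repM coordsK.
Qed.

(** The elements whose matrix converges form a subgroup, since products and inverses pass to the
    limit; it contains [S] by the deformation bound. *)
Lemma rep_mx_cvg (S : set Gamma) pi g : finite_set S -> generates S ->
  mx_cvg (F := near_rep S pi) (fun rho => rep_mx rho g) (rep_mx pi g).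
Proof.
move=> Sfin Sgen.
pose H := [pred g | `[< mx_cvg (F := near_rep S pi) (fun rho => rep_mx rho g) (rep_mx pi g) >]].
suff : g \in H by move=> /asboolP.
apply: (Sgen H).
  split=> [|x y /asboolP xH /asboolP yH]; apply/asboolP.
    rewrite (rep_mx1 pi); have -> : (fun rho => rep_mx rho 1%g) = fun=> 1%:M.
      by apply/funext => rho; rewrite rep_mx1.
    exact: mx_cvg_cst.
  rewrite rep_mxM; have -> : (fun rho => rep_mx rho (x / y)%g) =
      fun rho => rep_mx rho y^-1%g *m rep_mx rho x.
    by apply/funext => rho; rewrite rep_mxM.
  apply: mx_cvg_mul => //.
  have inv rho : rep_mx rho y^-1%g *m rep_mx rho y = 1%:M.
    by rewrite -rep_mxM mulgV rep_mx1.
  have [piVu piu] := mulmx1_unit (inv pi).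
  have -> : rep_mx pi y^-1%g = invmx (rep_mx pi y).
    by rewrite -[LHS]mulmx1 -(mulmxV piu) mulmxA inv mul1mx.
  exact: (mx_cvg_inv (fun rho => rep_mx rho y) _ _ yH inv piu).
move=> s Ss; apply/asboolP => i j.
have [C C0 CP] := coordinate_bound HK c (can_inj eK).
have [N N0 NE] := real_norm_exists HK (E := E).
apply/cvgrPdist_lt => d d0.
(* Chosen so that [2 * eps * N (c i) < d * C]; the added [1] keeps the denominator positive. *)
exists (d * C / (2 * (N (c i) + 1))).
  by rewrite divr_gt0 ?mulr_gt0 // ltr_wpDl.
move=> rho dpr.
set eps := d * C / _ in dpr.
have eps0 : 0 < eps by rewrite divr_gt0 ?mulr_gt0 // ltr_wpDl.
have ei : e (delta_mx 0 i) = c i.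
  rewrite /real_combination (bigD1 i) //= mxE !eqxx (emb1 HK) scale1r big1 ?addr0 //.
  by move=> k /negPf ki; rewrite mxE ki andbF (emb0 HK) scale0r.
have := deformation_bound S eps pi rho Sfin eps0 dpr s Ss (c i).
rewrite -[pi s _ - rho s _]coordsK => /(le_trans (CP _ j)).
rewrite -NE -(embM HK) (ler_emb HK) coordsB !mxE !ei => h.
have : C * `|coords (pi s (c i)) 0 j - coords (rho s (c i)) 0 j| < C * d.
  apply: le_lt_trans h _.
  have -> : 2 * eps * N (c i) = d * C * (N (c i) / (N (c i) + 1)).
    by rewrite /eps; field; rewrite gt_eqF // ltr_wpDl.
  rewrite mulrC [C * d]mulrC gtr_pMl ?mulr_gt0 //.
  by rewrite ltr_pdivrMr ?ltr_wpDl // mul1r ltrDl.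
by rewrite ltr_pM2l.
Qed.

End Deformations.

(** * Matrices of the coboundary *)

Section CochainMatrices.
Context {R : realType} {K : numFieldType} {emb : R -> K}.
Hypothesis HK : scalar_field emb.
Context {Gamma : groupType} {E : normedModType K}.
Context {q : nat} {c : 'I_q -> E} (coords : E -> 'rV[R]_q).
Local Notation e := (@real_combination R K emb E q c).
Hypothesis coordsK : cancel coords e.
Hypothesis eK : cancel e coords.
Context {V : choiceType} (a : Gamma -> V -> V) (u : V -> Gamma) (P : seq V -> Prop).
Hypothesis a1 : forall v, a 1%g v = v.
Hypothesis aM : forall g h v, a (g * h)%g v = a g (a h v).
Hypothesis ua : forall g v, u (a g v) = (g * u v)%g.
Hypothesis Pface : forall s t, P s -> is_face t s -> P t.
Hypothesis Pa : forall g s, P s -> P (map (a g) s).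
(* [N k] lists the simplices [v :: s] of size [k] with [u v = 1], which form a
   system of representatives of the orbits. *)
Variable N : nat -> seq (seq V).
Hypothesis Nuniq : forall k, uniq (N k).
Hypothesis NP : forall k s, s \in N k -> [/\ P s, size s = k &
  exists v t, s = v :: t /\ u v = 1%g].
Hypothesis Ncomplete : forall k v s, P (v :: s) -> size (v :: s) = k ->
  u v = 1%g -> v :: s \in N k.
Implicit Types rho : representation Gamma E.

(** The equivariant cochain with prescribed coordinates on the representatives. At most one index
    contributes to the sum, none if the normalized list is absent from [N k]. *)
Definition cochain_of_mx {k} rho (X : 'M[R]_(size (N k), q)) (s : seq V) : E :=
  if s is x :: _ then
    rho (u x) (e (\sum_(i < size (N k) | nth [::] (N k) i == map (a (u x)^-1%g) s)
                   row i X))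
  else 0.

Definition mx_of_cochain k (f : seq V -> E) : 'M[R]_(size (N k), q) :=
  \matrix_(i < size (N k)) coords (f (nth [::] (N k) i)).

Let map_aV g s : map (a g) (map (a g^-1%g) s) = s.
Proof.
by rewrite -map_comp -[RHS]map_id; apply: eq_map => v /=; rewrite -aM mulgV a1.
Qed.

Lemma cochain_of_mx_equivariant k rho (X : 'M[R]_(size (N k), q)) :
  equivariant a rho (cochain_of_mx rho X).
Proof.
move=> g [|x s]; first by rewrite raddf0.
rewrite /= ua repM; congr (rho g (rho _ (e _))); apply: eq_bigl => i.
congr (_ == _ :: _).
  by rewrite -aM invgM -mulgA mulVg mulg1.
by rewrite -map_comp; apply: eq_map => v /=; rewrite -aM invgM -mulgA mulVg mulg1.
Qed.

Lemma cochain_of_mx_nth k rho (X : 'M[R]_(size (N k), q)) (i : 'I_(size (N k))) :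
  cochain_of_mx rho X (nth [::] (N k) i) = e (row i X).
Proof.
have [_ _ [v [t [sE uv]]]] := NP k _ (mem_nth [::] (ltn_ord i)).
rewrite sE /= uv rep1 (bigD1 i) /=; last first.
  rewrite sE invg1 a1; apply/eqP; congr cons.
  by rewrite -[LHS]map_id; apply: eq_map => w; rewrite a1.
rewrite big1 ?addr0 // => j /andP[/eqP jE] /negP ji; case: ji.
apply/eqP/val_inj/eqP; rewrite -(nth_uniq [::] (ltn_ord j) (ltn_ord i) (Nuniq k)) jE sE invg1 a1.
by apply/eqP; congr cons; rewrite -[RHS]map_id; apply: eq_map => w; rewrite a1.
Qed.

Lemma cochain_of_mxK k rho (X : 'M[R]_(size (N k), q)) :
  mx_of_cochain k (cochain_of_mx rho X) = X.
Proof. by apply/row_matrixP => i; rewrite rowK cochain_of_mx_nth eK. Qed.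

Lemma mx_of_cochainK k rho f s : equivariant a rho f ->
  P s -> size s = k -> s <> [::] ->
  cochain_of_mx rho (mx_of_cochain k f) s = f s.
Proof.
case: s => // x s fe Ps sk _; set t := map (a (u x)^-1%g) (x :: s).
have tN : t \in N k.
  apply: (Ncomplete k (a (u x)^-1%g x) (map (a (u x)^-1%g) s)); first exact: (Pa _ _ Ps).
    by rewrite -sk /= size_map.
  by rewrite ua mulVg.
rewrite -index_mem in tN; have tE := nth_index [::] (_ : t \in N k).
rewrite -(map_aV (u x) (x :: s)) -/t fe cochain_of_mx_equivariant; congr (rho _ _).
rewrite -tE -?index_mem // (cochain_of_mx_nth _ _ _ (Ordinal tN)).
by rewrite rowK coordsK.
Qed.

Lemma cochain_of_mxB k rho (X Y : 'M[R]_(size (N k), q)) s :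
  cochain_of_mx rho (X - Y) s = cochain_of_mx rho X s - cochain_of_mx rho Y s.
Proof.
case: s => [|x s] /=; first by rewrite subr0.
rewrite -raddfB -(real_combinationB HK) -sumrB; congr (rho _ (e _)).
by apply: eq_bigr => i _; rewrite linearB.
Qed.

Lemma cochain_of_mxZ k rho r (X : 'M[R]_(size (N k), q)) s :
  cochain_of_mx rho (r *: X) s = emb r *: cochain_of_mx rho X s.
Proof.
case: s => [|x s] /=; first by rewrite scaler0.
rewrite -linearZ -(real_combinationZ HK) scaler_sumr; congr (rho _ (e _)).
by apply: eq_bigr => i _; rewrite linearZ.
Qed.

Definition codiff_mx {k} rho (X : 'M[R]_(size (N k), q)) : 'M[R]_(size (N k.+1), q) :=
  mx_of_cochain k.+1 (codiff (cochain_of_mx rho X)).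

Lemma codiff_mxE k rho (X : 'M[R]_(size (N k), q)) s : P s -> size s = k.+1 ->
  cochain_of_mx rho (codiff_mx rho X) s = codiff (cochain_of_mx rho X) s.
Proof.
move=> Ps sk; apply: mx_of_cochainK => //; last by move=> s0; rewrite s0 in sk.
exact/equivariant_codiff/cochain_of_mx_equivariant.
Qed.

Lemma eq_mx_of_cochain k (f h : seq V -> E) :
  (forall s, P s -> size s = k -> f s = h s) -> mx_of_cochain k f = mx_of_cochain k h.
Proof.
move=> fh; apply/row_matrixP => i; rewrite !rowK.
by have [Ps sk _] := NP k _ (mem_nth [::] (ltn_ord i)); rewrite fh.
Qed.

Lemma mx_of_cochain0 k : mx_of_cochain k (fun=> 0) = 0.
Proof.
apply/row_matrixP => i; rewrite rowK row0; apply: (can_inj eK).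
by rewrite coordsK -[0 in RHS](subrr 0) (real_combinationB HK) subrr.
Qed.

Lemma codiff_mx_codiff_mx k rho (X : 'M[R]_(size (N k), q)) :
  codiff_mx rho (codiff_mx rho X) = 0.
Proof.
rewrite -(mx_of_cochain0 k.+2); apply: eq_mx_of_cochain => s Ps sk.
rewrite -[RHS](codiff_codiff (cochain_of_mx rho X) s); apply: eq_codiff => t ts.
apply: codiff_mxE; first exact: Pface ts.
by move: sk; rewrite (is_face_size _ _ ts) => -[].
Qed.

(** For positive [n] the faces of a list of size [n.+1] are nonempty, so on those in [P] a cochain
    is determined by its matrix. *)
Lemma vanishes_codiff_mx rho n : (0 < n)%N ->
  vanishes a P rho n <->
  forall Y : 'M[R]_(size (N n.+1), q), codiff_mx rho Y = 0 ->
    exists X : 'M[R]_(size (N n), q), codiff_mx rho X = Y.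
Proof.
move=> n0; split=> [van Y Y0|ex f fe f0].
  have [|s Ps sn|h he hE] := van (cochain_of_mx rho Y).
  - exact: cochain_of_mx_equivariant.
  - rewrite -codiff_mxE // Y0 -(mx_of_cochain0 n.+2) (mx_of_cochainK _ _ (fun=> 0)) //.
      by move=> g t; rewrite raddf0.
    by move=> s0; rewrite s0 in sn.
  exists (mx_of_cochain n h); rewrite -[RHS](cochain_of_mxK _ rho Y).
  apply: eq_mx_of_cochain => s Ps sn; rewrite hE //; apply: eq_codiff => t ts.
  have tn : size t = n by move: sn; rewrite (is_face_size _ _ ts) => -[].
  apply: mx_of_cochainK => //; first exact: Pface ts.
  by move=> t0; rewrite t0 /= in tn; rewrite -tn in n0.
have fE s : P s -> size s = n.+1 -> cochain_of_mx rho (mx_of_cochain n.+1 f) s = f s.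
  move=> Ps sn; apply: mx_of_cochainK => //.
  by move=> s0; rewrite s0 in sn.
have [|X XE] := ex (mx_of_cochain n.+1 f).
  rewrite -(mx_of_cochain0 n.+2); apply: eq_mx_of_cochain => s Ps sn.
  rewrite -(f0 s Ps sn); apply: eq_codiff => t ts; apply: fE; first exact: Pface ts.
  by move: sn; rewrite (is_face_size _ _ ts) => -[].
exists (cochain_of_mx rho X); first exact: cochain_of_mx_equivariant.
by move=> s Ps sn; rewrite -codiff_mxE // XE fE.
Qed.

(** Here [k] is the size of the lists, so this is the coboundary from degree [k - 1] to degree
    [k]. *)
Definition codiff_operator k rho :
    'M[R]_(size (N k) * q, size (N k.+1) * q) :=
  matrix_of (fun x => mxvec (@codiff_mx k rho (vec_mx x))).

Lemma codiff_mxB k rho : {morph @codiff_mx k rho : X Y / X - Y}.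
Proof.
move=> X Y; apply/row_matrixP => i.
rewrite linearB /= !rowK -(coordsB HK _ coordsK eK) -codiffB; congr (coords _).
by apply: eq_codiff => t _; exact: cochain_of_mxB.
Qed.

Lemma codiff_mxZ k rho r : {morph @codiff_mx k rho : X / r *: X}.
Proof.
move=> X; apply/row_matrixP => i.
rewrite linearZ /= !rowK -(coordsZ HK _ coordsK eK); congr (coords _).
rewrite -(codiff_additive (fun x => emb r *: x)) => [|x y]; last exact: scalerBr.
by apply: eq_codiff => t _; exact: cochain_of_mxZ.
Qed.

Lemma mul_codiff_operator k rho x :
  x *m codiff_operator k rho = mxvec (codiff_mx rho (vec_mx x)).
Proof.
rewrite mul_matrix_of // => [y z|r y].
  by rewrite linearB codiff_mxB linearB.
by rewrite linearZ /= codiff_mxZ linearZ.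
Qed.

Lemma vanishes_exact rho n : (0 < n)%N ->
  vanishes a P rho n <->
  (kermx (codiff_operator n.+1 rho) <= codiff_operator n rho)%MS.
Proof.
move=> n0; rewrite vanishes_codiff_mx //; split=> [ex|le Y Y0].
  apply/row_subP => i; set y := row i _.
  have : y *m codiff_operator n.+1 rho = 0 by apply/sub_kermxP; exact: row_sub.
  rewrite mul_codiff_operator => /(congr1 vec_mx); rewrite mxvecK linear0 => /ex[X XE].
  by apply/submxP; exists (mxvec X); rewrite mul_codiff_operator mxvecK XE vec_mxK.
have /submxP[x xE] : (mxvec Y <= codiff_operator n rho)%MS.
  apply: submx_trans le; apply/sub_kermxP.
  by rewrite mul_codiff_operator mxvecK Y0 linear0.
by exists (vec_mx x); apply: (can_inj mxvecK); rewrite xE mul_codiff_operator.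
Qed.

Lemma codiff_operator_mul k rho :
  codiff_operator k rho *m codiff_operator k.+1 rho = 0.
Proof.
apply/row_matrixP => i; rewrite !rowE mulmxA !mul_codiff_operator mxvecK.
by rewrite codiff_mx_codiff_mx linear0 mulmx0.
Qed.

Section Limits.
Variables (S : set Gamma) (pi : representation Gamma E).
Hypothesis Sfin : finite_set S.
Hypothesis Sgen : generates S.
Local Notation F := (near_rep (emb := emb) S pi).

Lemma codiff_cvg (h : representation Gamma E -> seq V -> E) s :
  (forall t, mx_cvg (F := F) (fun rho => coords (h rho t)) (coords (h pi t))) ->
  mx_cvg (F := F) (fun rho => coords (codiff (h rho) s)) (coords (codiff (h pi) s)).
Proof.
elim: s h => [|x s IH] h hc /=; first exact: mx_cvg_cst.
rewrite (coordsB HK _ coordsK eK).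
have -> : (fun rho => coords (h rho s - codiff (fun t => h rho (x :: t)) s)) =
    fun rho => coords (h rho s) - coords (codiff (fun t => h rho (x :: t)) s).
  by apply/funext => rho; rewrite (coordsB HK _ coordsK eK).
apply: (mx_cvgB _ _ _ _ (hc s)).
exact: (IH (fun rho t => h rho (x :: t)) (fun t => hc (x :: t))).
Qed.

(** Each entry is a coordinate of the coboundary of a basis cochain, that is, of a signed sum of
    operators [rho (u x)] applied to vectors independent of [rho]. *)
Lemma codiff_operator_cvg k :
  mx_cvg (F := F) (fun rho => codiff_operator k rho) (codiff_operator k pi).
Proof.
move=> i j; case/mxvec_indexP: j => i' j'.
pose X : 'M[R]_(size (N k), q) := vec_mx (delta_mx 0 i).
pose s := nth [::] (N k.+1) i'.
have opE rho : codiff_operator k rho i (mxvec_index i' j') =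
    coords (codiff (cochain_of_mx rho X) s) 0 j'.
  by rewrite mxE mxvecE mxE.
rewrite opE (funext opE).
apply: (codiff_cvg (fun rho => cochain_of_mx rho X)) => -[|x t] /=.
  exact: mx_cvg_cst.
set r := \sum_(l < _ | _) _.
rewrite -(mul_rep_mx HK _ coordsK eK).
have -> : (fun rho => coords (rho (u x) (e r))) =
    fun rho : representation Gamma E => r *m rep_mx (emb := emb) (c := c) coords rho (u x).
  by apply/funext => rho; rewrite (mul_rep_mx HK _ coordsK eK).
apply: mx_cvg_mul; first exact: mx_cvg_cst.
exact: rep_mx_cvg.
Qed.

Lemma vanishes_open n : (0 < n)%N -> vanishes a P pi n ->
  exists2 eps : R, 0 < eps & forall rho, deformation emb S eps pi rho -> vanishes a P rho n.
Proof.
move=> n0 /(vanishes_exact _ _ n0) ex.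
have [eps eps0 epsP] := exact_open _ _ _ _ (codiff_operator_mul n)
  (codiff_operator_cvg n) (codiff_operator_cvg n.+1) ex.
by exists eps => // rho /epsP; exact: (vanishes_exact _ _ n0).2.
Qed.

End Limits.

End CochainMatrices.

Theorem corollary6 (R : realType) (K : numFieldType) (emb : R -> K)
    (HK : scalar_field emb)
    (n : nat) (Hn : (1 <= n)%N)
    (Gamma : groupType) (X : eilenberg_maclane R Gamma)
    (HX : finite_skeleton (em_base X) n.+1)
    (S : set Gamma) (Sfin : finite_set S) (Sgen : generates S)
    (E : completeNormedModType K) (Efin : finite_dimensional E)
    (pi : representation Gamma E)
    (Hpi : cohomology_vanishes pi n) :
  exists2 eps : R, 0 < eps &
    forall rho : representation Gamma E,
      deformation emb S eps pi rho -> cohomology_vanishes rho n.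
Proof.
have [u ua] := orbit_coordinate X.
pose a g v := em_act X g v.
pose P := @spans_simplex (em_cover X).
have a1 v : a 1%g v = v by exact: em_act1.
have aM g h v : a (g * h)%g v = a g (a h v) by exact: em_actM.
have P0 : P [::] by [].
have Pface s t : P s -> is_face t s -> P t.
  by move=> Ps /is_face_sub ts; exact: spans_simplexS ts Ps.
have Pa g s : P s -> P (map (a g) s) by exact: spans_simplex_map.
have Pacyclic k (z : @chain E _) := contractible_acyclic k z (em_cover_contractible X).
have [v0 _] : exists v : vertex (em_cover X), True.
  have [x0 _] := em_cover_contractible X.
  have [s [ss _ _ _]] := coordP x0.
  by have /fset0Pn[v _] := simplex_neq0 ss; exists v.
have av0 g h : a (g * h)%g v0 = a g (a h v0) := aM g h v0.
have /choice[N0 N0P] k := finite_normalized_simplices X u n.+1 k HX ua.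
pose N k := undup [seq s <- N0 k | `[< [/\ P s, size s = k &
  exists v t, s = v :: t /\ u v = 1%g] >]].
have NP k s : s \in N k -> [/\ P s, size s = k & exists v t, s = v :: t /\ u v = 1%g].
  by rewrite mem_undup mem_filter => /andP[/asboolP].
have Ncomplete k v s : P (v :: s) -> size (v :: s) = k -> u v = 1%g -> v :: s \in N k.
  move=> Ps sk uv; rewrite mem_undup mem_filter N0P // andbT; apply/asboolP.
  by split=> //; exists v, s.
have [q [c [coords eK coordsK]]] := real_basis HK Efin.
(* All data here are chosen before [rho], so the equivalence serves both for [pi] and for its
   deformations. The orbit map of [v0] and [u] are the two equivariant maps between [Gamma] and the
   vertices. *)
have reduce (rho : representation Gamma E) : cohomology_vanishes rho n <-> vanishes a P rho n.
  rewrite cohomology_vanishesP //; split.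
    move/(vanishes_transfer (fun g h => g * h)%g a (fun h => a h v0) u rho n av0 ua).
    exact: (vanishes_restrict a u P a1 aM ua P0 Pface Pa Pacyclic).
  move/(vanishes_extend a u P a1 aM ua P0 Pface Pa Pacyclic).
  exact: (vanishes_transfer a (fun g h => g * h)%g u (fun h => a h v0) rho n ua av0).
have [eps eps0 epsP] := vanishes_open HK coords coordsK eK a u P
  a1 aM ua Pface Pa N (fun k => undup_uniq _) NP Ncomplete
  S pi Sfin Sgen n Hn ((reduce pi).1 Hpi).
by exists eps => // rho /epsP /reduce.
Qed.
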